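(* Let $0<m<n$ be integers. Then (a) the set $\mathcal{T}_{(m)}$ of comb representatives in $\mathfrak{n}_{(m)}^*$ is a set of supercharacter representatives for $U_{(m)}$, i.e. every two-sided $U_{(m)}$-orbit in $\mathfrak{n}_{(m)}^*$ contains exactly one element of $\mathcal{T}_{(m)}$ (so that $\lambda\mapsto\chi^\lambda$ is a bijection from $\mathcal{T}_{(m)}$ to the supercharacters of $U_{(m)}$); and (b) the set $\mathcal{Z}_{(m)}$ of path representatives in $\mathfrak{n}_{(m)}^*$ is a set of supercharacter representatives for $U_{(m)}$ in the same sense.
   Context: Let $\mathbb{F}_q$ be a finite field with $q$ elements and $U_n$ the group of $n\times n$ unipotent upper-triangular matrices over $\mathbb{F}_q$. For $0\le m\le n$ let $U=U_{(m)}=\{u\in U_n : u_{1j}=0 \text{ for } 1<j\le m\}$, $\mathfrak{n}_{(m)}=\{u-1 : u\in U_{(m)}\}$, and $\mathfrak{n}_{(m)}^*$ the space of $\mathbb{F}_q$-linear maps $\lambda:\mathfrak{n}_{(m)}\to\mathbb{F}_q$. The group $U$ acts on $\mathfrak{n}_{(m)}^*$ on the left and right by $(u\lambda v)(x-1)=\lambda(u^{-1}(x-1)v^{-1})$ for $u,v,x\in U$. Fix a nontrivial homomorphism $\theta:\mathbb{F}_q^+\to\mathbb{C}^\times$. The supercharacter of $U$ attached to $\lambda$ is $$\chi^\lambda(x)=\frac{|U\lambda|}{|U\lambda U|}\sum_{\mu\in U\lambda U}\theta(-\mu(x-1)),\qquad x\in U;$$ it depends only on the two-sided orbit $U\lambda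 U$. A functional $\lambda\in\mathfrak{n}_{(m)}^*$ is identified with the matrix having entries $\lambda_{ij}=\lambda(e_{ij})$ whenever the matrix unit $e_{ij}$ lies in $\mathfrak{n}_{(m)}$, and zeroes elsewhere. For a matrix $A$, let $G_A$ be the graph whose vertices are the nonzero entries of $A$ (labelled by their positions), with an edge joining two distinct nonzero entries whenever they lie in the same row or in the same column. Comb representative: $\lambda\in\mathfrak{n}_{(m)}^*$ is a comb representative if (i) at most one connected component of $G_\lambda$ has more than one vertex, and (ii) if $G_\lambda$ has a connected component $S$ with more than one vertex, then there are $r\ge1$, $r'\in\{r-1,r\}$ and integers $n\ge k_1>k_2>\cdots>k_r>m\ge i_{r'}>i_{r'-1}>\cdots>i_1>1$ such that the set of positions of the vertices of $S$ is exactly $$\{(1,k_1)\}\cup\{(i_d,k_1):1\le d\le r'\}\cup\{(i_d,k_{d+1}):1\le d\le r-1\}.$$ Path representative: $\lambda\in\mathfrak{n}_{(m)}^*$ is a path representative if (i) at most one connected component of $G_\lambda$ has more than one vertex, and (ii) if $G_\lambda$ has a connected component $S$ with more than one vertex, then there are $r\ge1$, $r'\in\{r-1,r\}$ and integers $n\ge k_1>k_2>\cdots>k_r>m\ge i_{r'}>i_{r'-1}>\cdots>i_1>1$ such that the set of positions of the vertices of $S$ is exactly $$\{(1,k_1)\}\cup\{(i_d,k_d):1\le d\le r'\}\cup\{(i_d,k_{d+1}):1\le d\le r-1\}.$$ $\mathcal{T}_{(m)}$ is the set of all comb representatives and $\mathcal{Z}_{(m)}$ the set of all path representatives in $\mathfrak{n}_{(m)}^*$.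 *)

(* Defs.v *)
From HB Require Import structures.
From mathcomp Require Import all_boot all_algebra finfield.
From mathcomp Require Import reals complex.

Set Implicit Arguments.
Unset Strict Implicit.
Unset Printing Implicit Defensive.

Import GRing.Theory.
Local Open Scope ring_scope.

(* Ordinals start at 0 while rows and columns of matrices are numbered from 1:
   the row (or column) number of i : 'I_n is i.+1. *)

Definition unipotent (F : finFieldType) (n : nat) : {set 'M[F]_n} :=
  [set u : 'M[F]_n | [forall i, u i i == 1] &&
                     [forall i : 'I_n, forall j : 'I_n, (j < i)%N ==> (u i j == 0)]].

Definition Um (F : finFieldType) (n m : nat) : {set 'M[F]_n} :=
  [set u in unipotent F n |
     [forall i : 'I_n, forall j : 'I_n,
        [&& i.+1 == 1, 1 < j.+1 & j.+1 <= m]%N ==> (u i j == 0)]].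

(* The matrices u - 1 with u in Um already form a subspace (see mem_nm), so
   taking the span only packages them as a {vspace _}. *)
Definition nm (F : finFieldType) (n m : nat) : {vspace 'M[F]_n} :=
  <<[seq u - 1%:M | u in Um F n m]>>%VS.

(* finvect_type equips the dual space with its finType structure. *)
Definition dual (F : finFieldType) (n m : nat) : finType :=
  finvect_type 'Hom(subvs_of (nm F n m), F^o).

Section Supercharacters.

Variables (F : finFieldType) (n m : nat).
Implicit Types (u v x : 'M[F]_n) (l mu : dual F n m).

(* vsproj is the identity on nm; ev is only meaningful for x in nm. *)
Definition ev l x : F :=
  fun_of_lfun (l : 'Hom(subvs_of (nm F n m), F^o)) (vsproj (nm F n m) x).

Definition act u l v : dual F n m :=
  linfun (fun y : subvs_of (nm F n m) =>
            ev l (invmx u *m vsval y *m invmx v) : F^o).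

Definition left_orbit l : {set dual F n m} :=
  [set act u l 1%:M | u in Um F n m].

Definition two_sided_orbit l : {set dual F n m} :=
  [set act u l v | u in Um F n m, v in Um F n m].

Definition supercharacter (C : fieldType) (theta : F -> C) l :
    {ffun {x : 'M[F]_n | x \in Um F n m} -> C} :=
  [ffun x => #|left_orbit l|%:R / #|two_sided_orbit l|%:R *
             \sum_(mu in two_sided_orbit l) theta (- ev mu (val x - 1%:M))].

(* Each two-sided orbit meets T exactly once, and l |-> supercharacter theta l
   is a bijection from T to the set of all supercharacters. *)
Definition supercharacter_representatives (C : fieldType) (theta : F -> C)
    (T : dual F n m -> Prop) : Prop :=
  [/\ forall l, exists! mu, mu \in two_sided_orbit l /\ T mu,
      forall l mu, T l -> T mu ->
        supercharacter theta l = supercharacter theta mu -> l = mu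
    & forall l, exists mu, T mu /\ supercharacter theta mu = supercharacter theta l].

Definition mx_of_dual l : 'M[F]_n :=
  \matrix_(i, j) if delta_mx i j \in nm F n m then ev l (delta_mx i j) else 0.

End Supercharacters.

Section EntryGraph.

Variables (F : finFieldType) (n : nat) (A : 'M[F]_n).

Definition entry_vertices : {set 'I_n * 'I_n} := [set p | A p.1 p.2 != 0].

Definition entry_edge : rel ('I_n * 'I_n) := fun p p' =>
  [&& p \in entry_vertices, p' \in entry_vertices, p != p'
    & (p.1 == p'.1) || (p.2 == p'.2)].

Definition entry_components : {set {set 'I_n * 'I_n}} :=
  [set [set p' | connect entry_edge p p'] | p in entry_vertices].

Definition big_components : {set {set 'I_n * 'I_n}} :=
  [set S in entry_components | (1 < #|S|)%N].

End EntryGraph.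

(* r >= 1, r' = r - 1 or r, and
   n >= k 1 > ... > k r > m >= i r' > ... > i 1 > 1;
   only the values k 1, ..., k r and i 1, ..., i r' matter. *)
Definition index_chain (n m r r' : nat) (k i : nat -> nat) : Prop :=
  [/\ (1 <= r)%N /\ (r' = r.-1 \/ r' = r),
      forall d, (1 <= d <= r)%N -> (m < k d <= n)%N,
      forall d e, (1 <= d)%N -> (d < e)%N -> (e <= r)%N -> (k e < k d)%N,
      forall d, (1 <= d <= r')%N -> (1 < i d <= m)%N
    & forall d e, (1 <= d)%N -> (d < e)%N -> (e <= r')%N -> (i d < i e)%N].

Definition comb_shape (n m : nat) (S : {set 'I_n * 'I_n}) : Prop :=
  exists (r r' : nat) (k i : nat -> nat), index_chain n m r r' k i /\
    forall p : 'I_n * 'I_n, p \in S <->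
      [\/ (p.1.+1, p.2.+1) = (1, k 1)%N,
          exists2 d, (1 <= d <= r')%N & (p.1.+1, p.2.+1) = (i d, k 1%N)
        | exists2 d, (1 <= d <= r.-1)%N & (p.1.+1, p.2.+1) = (i d, k d.+1)].

Definition path_shape (n m : nat) (S : {set 'I_n * 'I_n}) : Prop :=
  exists (r r' : nat) (k i : nat -> nat), index_chain n m r r' k i /\
    forall p : 'I_n * 'I_n, p \in S <->
      [\/ (p.1.+1, p.2.+1) = (1, k 1)%N,
          exists2 d, (1 <= d <= r')%N & (p.1.+1, p.2.+1) = (i d, k d)
        | exists2 d, (1 <= d <= r.-1)%N & (p.1.+1, p.2.+1) = (i d, k d.+1)].

Definition comb_representative (F : finFieldType) (n m : nat)
    (l : dual F n m) : Prop :=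
  (#|big_components (mx_of_dual l)| <= 1)%N /\
  forall S, S \in big_components (mx_of_dual l) -> comb_shape m S.

Definition path_representative (F : finFieldType) (n m : nat)
    (l : dual F n m) : Prop :=
  (#|big_components (mx_of_dual l)| <= 1)%N /\
  forall S, S \in big_components (mx_of_dual l) -> path_shape m S.

Section SanityFacts.

Variables (F : finFieldType) (n m : nat).
Implicit Types (u v x : 'M[F]_n).

Lemma mem_UmP u :
  reflect [/\ forall i, u i i = 1, forall i j : 'I_n, (j < i)%N -> u i j = 0
            & forall i j : 'I_n, i = 0%N :> nat -> (0 < j < m)%N -> u i j = 0]
          (u \in Um F n m).
Proof.
rewrite !inE -andbA; apply: (iffP and3P) => -[h1 h2 h3]; split.
- by move=> i; apply/eqP/(forallP h1).
- by move=> i j ij; apply/eqP; move/forallP/(_ i)/forallP/(_ j)/implyP: h2; apply.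
- move=> i j i0 jm; apply/eqP; move/forallP/(_ i)/forallP/(_ j)/implyP: h3.
  by apply; rewrite i0.
- by apply/forallP => i; rewrite h1.
- by apply/forallP => i; apply/forallP => j; apply/implyP => ?; rewrite h2.
- apply/forallP => i; apply/forallP => j; apply/implyP => /and3P[/eqP[i0] j0 jm].
  by rewrite h3 // jm andbT.
Qed.

Lemma Um_add1 x :
  (forall i j : 'I_n, (j <= i)%N -> x i j = 0) ->
  (forall i j : 'I_n, i = 0%N :> nat -> (j < m)%N -> x i j = 0) ->
  x + 1%:M \in Um F n m.
Proof.
move=> h1 h2; apply/mem_UmP; split.
- by move=> i; rewrite !mxE h1 // eqxx add0r.
- by move=> i j ji; rewrite !mxE h1 1?ltnW // -val_eqE /= gtn_eqF // addr0.
- move=> i j i0 /andP[j0 jm].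
  by rewrite !mxE h2 // -val_eqE /= i0 ltn_eqF // addr0.
Qed.

Lemma mem_nmP x :
  reflect [/\ forall i j : 'I_n, (j <= i)%N -> x i j = 0
            & forall i j : 'I_n, i = 0%N :> nat -> (j < m)%N -> x i j = 0]
          (x \in nm F n m).
Proof.
apply: (iffP idP) => [|[h1 h2]].
  have U0 u : u \in Um F n m ->
    (forall i j : 'I_n, (j <= i)%N -> (u - 1%:M) i j = 0) /\
    (forall i j : 'I_n, i = 0%N :> nat -> (j < m)%N -> (u - 1%:M) i j = 0).
    case/mem_UmP => d1 d2 d3.
    have e1 (i j : 'I_n) : (j <= i)%N -> (u - 1%:M) i j = 0.
      rewrite !mxE leq_eqVlt => /orP[/eqP/val_inj->|ji].
        by rewrite d1 eqxx subrr.
      by rewrite d2 // -val_eqE /= gtn_eqF // subrr.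
    split=> // i j i0 jm; case: (posnP j) => [j0|j0].
      by rewrite e1 // j0.
    rewrite !mxE d3 ?j0 //.
    by rewrite -val_eqE /= i0 ltn_eqF // subrr.
  have nU (a : 'I_#|Um F n m|) : exists2 u, u \in Um F n m &
      [seq u - 1%:M | u in Um F n m]`_a = u - 1%:M.
    by apply/imageP/mem_nth; rewrite size_image.
  move/coord_span ->; split=> [i j ji|i j i0 jm];
    rewrite summxE big1 // => a _; rewrite mxE;
    have [u uU ->] := nU a.
    by rewrite (U0 u uU).1 // mulr0.
  by rewrite (U0 u uU).2 // mulr0.
by apply/memv_span/imageP; exists (x + 1%:M); rewrite ?addrK // Um_add1.
Qed.

Lemma mem_nm x : (x \in nm F n m) = (x + 1%:M \in Um F n m).
Proof.
apply/idP/idP => [|xU].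
  by case/mem_nmP; apply: Um_add1.
by apply/memv_span/imageP; exists (x + 1%:M); rewrite ?addrK.
Qed.

Lemma act_val u v (l : dual F n m) x : x \in nm F n m ->
  ev (act u l v) x = ev l (invmx u *m x *m invmx v).
Proof.
move=> xn; rewrite /act {1}/ev.
pose f : subvs_of (nm F n m) -> F^o :=
  fun y => ev l (invmx u *m vsval y *m invmx v).
have lf : linear f.
  move=> a y z; rewrite /f /ev.
  rewrite [vsval _]linearP mulmxDr mulmxDl -scalemxAr -scalemxAl.
  by rewrite linearP [LHS]linearP.
pose fL := HB.pack_for {linear subvs_of (nm F n m) -> F^o} f
  (GRing.isLinear.Build _ _ _ _ f lf).
rewrite -[linfun _]/(linfun fL) lfunE /= /f.
by rewrite vsprojK.
Qed.

End SanityFacts.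

(* Main.v *)
Require Import Defs.
From HB Require Import structures.
From mathcomp Require Import all_boot all_algebra finfield.
From mathcomp Require Import reals complex zify ring.
From mathcomp Require boolp.
Import GRing.Theory Num.Theory.
Local Open Scope ring_scope.
Set Implicit Arguments.
Unset Strict Implicit.
Unset Printing Implicit Defensive.

(** On matrices, the two-sided orbit of A consists of the matrices L A R with L
    and R lower unitriangular (and L_{i1} = 0 for 1 < i <= m), truncated to the
    positions of n_(m).  Both families of representatives are normal forms built
    one row at a time: given the rows above, the stabilizer of these rows acts on
    the next row x by x |-> x R + w, with w in the span W of the rows above
    (without the first one when the new row is among the first m).  Modulo W, the
    columns used so far vanish, except that those of the comb or of the path all
    collapse to one line, the line of the first row, as long as the comb or path
    can still be continued.  This line is fixed by the stabilizer modulo columns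
    at most m, so a row attached to it cannot be cleared at columns
    m < j < k_r; this is where the second entry (i_r, k_{r+1}) comes from.  Combs
    and paths differ only in the column chosen to represent that line, k_1 or
    k_r.  Finally, the supercharacters of distinct orbits differ because the
    characters of n_(m) are orthogonal. *)

Section NormalForm.

Variables (F : fieldType) (n m : nat).
Implicit Types (A B L R : 'M[F]_n) (i j p q s k : 'I_n) (st : option ('I_n * 'I_n)).

Local Notation e j := (delta_mx 0 j : 'rV[F]_n).

Definition in_pattern i j := (i < j)%N && ((i == 0%N :> nat) ==> (m <= j)%N).

Definition pos_supported A := forall i j, ~~ in_pattern i j -> A i j = 0.

Definition fresh A (t : nat) j := [forall p : 'I_n, (p < t)%N ==> (A p j == 0)].

Definition rows_between A (lo hi : nat) : 'M[F]_n :=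
  \matrix_(p, j) if (lo <= p < hi)%N then A p j else 0.

(* The state is [Some (s, k)] while the comb or path can be continued: k is its
   leftmost column and s the column to which the next row attaches (the first
   column of a comb, the last one of a path). *)
Inductive row_step (comb : bool) A i :
    option ('I_n * 'I_n) -> 'rV[F]_n -> option ('I_n * 'I_n) -> Prop :=
  | StepZero st : row_step comb A i st 0 st
  | StepHead k c :
      i = 0%N :> nat -> c != 0 -> row_step comb A i None (c *: e k) (Some (k, k))
  | StepFresh st j c :
      (0 < i)%N -> c != 0 -> fresh A i j -> row_step comb A i st (c *: e j) st
  | StepClose s k c :
      (i < m)%N -> c != 0 -> row_step comb A i (Some (s, k)) (c *: e s) None
  | StepExtend s k j c c' :
      (i < m)%N -> c != 0 -> c' != 0 -> fresh A i j -> (m <= j < k)%N ->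
      row_step comb A i (Some (s, k)) (c *: e s + c' *: e j)
        (Some (if comb then s else j, j)).

Inductive normal_rows (comb : bool) A :
    nat -> option ('I_n * 'I_n) -> Prop :=
  | NormalNil : normal_rows comb A 0 None
  | NormalCons i st st' :
      normal_rows comb A i st -> row_step comb A i st (row i A) st' ->
      normal_rows comb A i.+1 st'.

(* The functional [phi] vanishes on the rows 1 to t - 1 and detects [e s], which
   modulo these rows is proportional to row 0. *)
Definition open_facts A (t : nat) s k (phi : 'cV[F]_n) :=
  [/\ [/\ (0 < t)%N, (m <= s)%N & (m <= k)%N],
      [/\ forall j, (j < k)%N -> phi j 0 = 0, phi k 0 != 0, phi s 0 != 0
        & forall j, fresh A t j -> phi j 0 = 0],
      forall p, (0 < p < t)%N -> row p A *m phi = 0,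
      (e s <= rows_between A 0 t)%MS
    & forall j, ~~ fresh A t j ->
        exists a, (e j - a *: e s <= rows_between A 1 t)%MS].

Definition state_facts A (t : nat) st : Prop :=
  match st with
  | None => forall j, ~~ fresh A t j -> (e j <= rows_between A 1 t)%MS
  | Some (s, k) => exists phi, open_facts A t s k phi
  end.

Lemma freshP A t j : reflect (forall p, (p < t)%N -> A p j = 0) (fresh A t j).
Proof.
apply: (iffP forallP) => [h p pt|h p].
  by apply/eqP; have := h p; rewrite pt.
by apply/implyP => /h ->.
Qed.

Lemma freshS A i j : fresh A i.+1 j = fresh A i j && (A i j == 0).
Proof.
apply/freshP/andP => [h|[/freshP h /eqP h' p]].
  by split; [apply/freshP => p pi; apply: h; lia | rewrite h].
rewrite ltnS leq_eqVlt => /orP[/eqP/val_inj -> //|]; exact: h.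
Qed.

Lemma row_rows_between A lo hi p :
  row p (rows_between A lo hi) = if (lo <= p < hi)%N then row p A else 0.
Proof. by apply/rowP => j; rewrite !mxE; case: ifP; rewrite !mxE. Qed.

Lemma rows_between_sub A lo hi (X : 'M[F]_n) :
  (forall p, (lo <= p < hi)%N -> (row p A <= X)%MS) ->
  (rows_between A lo hi <= X)%MS.
Proof.
move=> h; apply/row_subP => p; rewrite row_rows_between.
by case: ifP => [/h //|_]; rewrite sub0mx.
Qed.

Lemma row_sub_rows_between A lo hi p :
  (lo <= p < hi)%N -> (row p A <= rows_between A lo hi)%MS.
Proof.
by move=> h; have := row_sub p (rows_between A lo hi); rewrite row_rows_between h.
Qed.

Lemma rows_between_mono A lo hi lo' hi' : (lo' <= lo)%N -> (hi <= hi')%N ->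
  (rows_between A lo hi <= rows_between A lo' hi')%MS.
Proof.
by move=> ? ?; apply: rows_between_sub => p ?; apply: row_sub_rows_between; lia.
Qed.

Lemma row_entry (q : nat) (A : 'M[F]_(n, q)) i (j : 'I_q) : row i A 0 j = A i j.
Proof. by rewrite mxE. Qed.

Lemma mul_unit_row j (phi : 'cV[F]_n) : e j *m phi = (phi j 0)%:M.
Proof.
by rewrite -rowE; apply/matrixP => a b; rewrite !ord1 !mxE eqxx mulr1n.
Qed.

Lemma unit_row_entry j j' : e j 0 j' = (j' == j)%:R.
Proof. by rewrite mxE eqxx. Qed.

Lemma normal_rows_facts comb A t st : pos_supported A ->
  normal_rows comb A t st -> state_facts A t st.
Proof.
move=> sA; elim=> {t st} [j /negP[]|i st st' _ IH]; first exact/freshP.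
move ri: (row i A) => x stp; case: st x st' / stp ri IH.
- move=> st ri IH.
  have fr j : fresh A i.+1 j = fresh A i j.
    by rewrite freshS -row_entry ri mxE eqxx andbT.
  have W1 lo := @rows_between_mono A lo i lo i.+1 (leqnn _) (leqnSn _).
  case: st IH => [[s k] [phi [[h1 h2 h3] [h4 h5 h6 h7] h8 h9 h10]]|IH] /=.
    exists phi; split; [by split|split=> //| | |].
    + by move=> j; rewrite fr; apply: h7.
    + move=> p; rewrite ltnS [(p <= i)%N]leq_eqVlt => /andP[p0 /orP[/eqP/val_inj->|pi]].
        by rewrite ri mul0mx.
      by rewrite h8 // p0.
    + exact: submx_trans (W1 0%N).
    + move=> j; rewrite fr => /h10[a ha]; exists a; exact: submx_trans (W1 1%N).
  by move=> j; rewrite fr => /IH h; apply: submx_trans (W1 1%N).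
- move=> k c i0 c0 ri _.
  have pk : in_pattern i k.
    apply/contraT => /sA; rewrite -row_entry ri !mxE !eqxx mulr1 => h.
    by rewrite h eqxx in c0.
  have fr j : fresh A i.+1 j = (j != k).
    rewrite freshS -row_entry ri !mxE eqxx.
    have -> : fresh A i j by apply/freshP => p; rewrite i0.
    by case: (j == k); rewrite /= ?mulr1 ?mulr0 ?eqxx ?(negPf c0).
  have mk : (m <= k)%N by move: pk; rewrite /in_pattern i0 => /andP[].
  exists (e k)^T; split; [by split|split=> //| | |].
  + by move=> j jk; rewrite !mxE eqxx -val_eqE /= (ltn_eqF jk).
  + by rewrite !mxE !eqxx oner_eq0.
  + by rewrite !mxE !eqxx oner_eq0.
  + by move=> j; rewrite fr !mxE eqxx => /negPf ->.
  + by move=> p; lia.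
  + have -> : e k = c^-1 *: row i A by rewrite ri scalerA mulVf // scale1r.
    by apply/scalemx_sub/row_sub_rows_between; lia.
  + by move=> j; rewrite fr negbK => /eqP->; exists 1; rewrite scale1r subrr sub0mx.
- move=> st j c i0 c0 frj ri IH.
  have fr j' : fresh A i.+1 j' = fresh A i j' && (j' != j).
    rewrite freshS -row_entry ri !mxE eqxx.
    by case: (j' == j); rewrite /= ?mulr1 ?mulr0 ?eqxx ?(negPf c0) ?andbT ?andbF.
  have W1 lo := @rows_between_mono A lo i lo i.+1 (leqnn _) (leqnSn _).
  have ej : (e j <= rows_between A 1 i.+1)%MS.
    have -> : e j = c^-1 *: row i A by rewrite ri scalerA mulVf // scale1r.
    by apply/scalemx_sub/row_sub_rows_between; lia.
  case: st IH => [[s k] [phi [[h1 h2 h3] [h4 h5 h6 h7] h8 h9 h10]]|IH] /=.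
    exists phi; split; [by split|split=> //| | |].
    + by move=> j'; rewrite fr => /andP[/h7].
    + move=> p; rewrite ltnS [(p <= i)%N]leq_eqVlt => /andP[p0 /orP[/eqP/val_inj->|pi]].
        by rewrite ri -scalemxAl mul_unit_row h7 // raddf0 scaler0.
      by rewrite h8 // p0.
    + exact: submx_trans (W1 0%N).
    + move=> j'; rewrite fr negb_and negbK => /orP[/h10[a ha]|/eqP->].
        by exists a; exact: submx_trans (W1 1%N).
      by exists 0; rewrite scale0r subr0.
  move=> j'; rewrite fr negb_and negbK => /orP[/IH h|/eqP-> //].
  exact: submx_trans (W1 1%N).
- move=> s k c im c0 ri [phi [[h1 h2 h3] [h4 h5 h6 h7] h8 h9 h10]].
  have W1 lo := @rows_between_mono A lo i lo i.+1 (leqnn _) (leqnSn _).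
  have es : (e s <= rows_between A 1 i.+1)%MS.
    have -> : e s = c^-1 *: row i A by rewrite ri scalerA mulVf // scale1r.
    by apply/scalemx_sub/row_sub_rows_between; lia.
  have frs : ~~ fresh A i s by apply: contraNN h6 => /h7 ->.
  move=> j; rewrite freshS negb_and => /orP hj.
  have /h10[a ha] : ~~ fresh A i j.
    case: hj => //; rewrite -row_entry ri !mxE eqxx /=.
    by case: (eqVneq j s) => [-> //|_]; rewrite mulr0 eqxx.
  rewrite -[e j](subrK (a *: e s)) addmx_sub ?scalemx_sub //.
  exact: submx_trans (W1 1%N).
- move=> s k j c c' im c0 c'0 frj /andP[mj jk] ri.
  move=> [phi [[h1 h2 h3] [h4 h5 h6 h7] h8 h9 h10]].
  have W1 lo := @rows_between_mono A lo i lo i.+1 (leqnn _) (leqnSn _).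
  have frs : ~~ fresh A i s by apply: contraNN h6 => /h7 ->.
  have js : j != s by apply: contraNneq frs => <-.
  have riW lo : (lo <= 1)%N -> (row i A <= rows_between A lo i.+1)%MS.
    by move=> ?; apply: row_sub_rows_between; lia.
  have ejE : e j = c'^-1 *: (row i A - c *: e s).
    by rewrite ri addrAC subrr add0r scalerA mulVf // scale1r.
  have esE : e s = c^-1 *: (row i A - c' *: e j).
    by rewrite ri addrK scalerA mulVf // scale1r.
  have fr j' : ~~ fresh A i.+1 j' -> j' = j \/ ~~ fresh A i j'.
    rewrite freshS negb_and => /orP[|]; first by right.
    rewrite -row_entry ri !mxE eqxx /=.
    case: (eqVneq j' j) => [-> _|_]; first by left.
    by case: (eqVneq j' s) => [-> _|_]; [right | rewrite !mulr0 addr0 eqxx].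
  have frj' j' : fresh A i.+1 j' -> fresh A i j' /\ j' != j.
    rewrite freshS => /andP[-> h]; split=> //; apply: contraTneq h => ->.
    rewrite -row_entry ri !mxE !eqxx (negPf js) /= mulr0 add0r mulr1.
    exact: c'0.
  exists (phi - (c * phi s 0 / c') *: (e j)^T).
  have phij : phi j 0 = 0 by exact: h7.
  have newj : (phi - (c * phi s 0 / c') *: (e j)^T) j 0 != 0.
    rewrite !mxE phij !eqxx mulr1 sub0r oppr_eq0.
    by rewrite !mulf_neq0 // invr_eq0.
  have neww j' : j' != j -> (phi - (c * phi s 0 / c') *: (e j)^T) j' 0 = phi j' 0.
    by move=> /negPf h; rewrite !mxE h andbF mulr0 subr0.
  split; [by split=> //; case: (comb)|split=> //| | |].
  + move=> j' j'j; rewrite neww; first by apply: h4; lia.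
    by apply: contraTneq j'j => ->; rewrite ltnn.
  + by case: (comb) => //; rewrite neww // eq_sym; exact: js.
  + by move=> j' /frj'[f1 f2]; rewrite neww // h7.
  + move=> p; rewrite ltnS [(p <= i)%N]leq_eqVlt => /andP[p0 /orP[/eqP/val_inj->|pi]].
      rewrite ri mulmxDl -!scalemxAl !mul_unit_row neww 1?eq_sym // !mxE phij !eqxx sub0r mulr1.
      apply/matrixP => a b; rewrite !ord1 !mxE eqxx !mulr1n; field; exact: c'0.
    rewrite mulmxBr h8 ?p0 // sub0r -scalemxAr; apply/matrixP => a b.
    rewrite !ord1 !mxE big1 ?mulr0 ?oppr0 // => q _; rewrite !mxE eqxx /=.
    case: eqP => [->|_]; last by rewrite mulr0.
    by move/freshP: frj => ->; rewrite ?mul0r.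
  + have es := submx_trans h9 (W1 0%N).
    case: (comb) => //; rewrite ejE scalemx_sub // addmx_sub ?riW //.
    by rewrite eqmx_opp scalemx_sub.
  + move=> j' /fr[->|/h10[a ha]]; case: (comb).
    * exists (- c'^-1 * c); rewrite ejE scalerBr scalerA mulNr scaleNr opprK.
      by rewrite subrK scalemx_sub ?riW.
    * by exists 1; rewrite scale1r subrr sub0mx.
    * by exists a; exact: submx_trans (W1 1%N).
    * exists (- a * c^-1 * c').
      have -> : e j' - (- a / c * c') *: e j
             = (e j' - a *: e s) + (a / c) *: row i A.
        rewrite ri !scalerDr !scalerA divfK //.
        rewrite addrA subrK -scaleNr; congr (_ + _ *: _); ring.
      by rewrite addmx_sub ?scalemx_sub ?riW // (submx_trans ha) ?W1.
Qed.

End NormalForm.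

Section NormalFormUniqueness.

Variables (F : fieldType) (n m : nat).
Implicit Types (A B L R : 'M[F]_n) (i j p q s k : 'I_n) (st : option ('I_n * 'I_n)).

Local Notation e j := (delta_mx 0 j : 'rV[F]_n).
Local Notation allowed := (in_pattern m).
Local Notation row_step := (row_step m).
Local Notation normal_rows := (normal_rows m).

Definition lower_unip L :=
  [/\ forall i, L i i = 1, forall i j, (i < j)%N -> L i j = 0
    & forall i j, j = 0%N :> nat -> (0 < i < m)%N -> L i j = 0].

Lemma open_state_facts comb A t s k : pos_supported m A ->
  normal_rows comb A t (Some (s, k)) -> exists phi, open_facts m A t s k phi.
Proof. exact: normal_rows_facts. Qed.

Lemma fresh_eq A B t j : (forall p, (p < t)%N -> row p A = row p B) ->
  fresh A t j = fresh B t j.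
Proof.
move=> AB; apply/freshP/freshP => h p pt; have := h p pt; rewrite -[A p j]row_entry -[B p j]row_entry.
  by rewrite AB.
by rewrite -AB.
Qed.

Lemma mulmx_lower (q : nat) L (A : 'M[F]_(n, q)) i (j : 'I_q) : lower_unip L ->
  (L *m A) i j = A i j + \sum_(p : 'I_n | (p < i)%N) L i p * A p j.
Proof.
move=> [L1 L2 _]; rewrite mxE (bigD1 i) //= L1 mul1r; congr (_ + _).
rewrite [LHS](bigID (fun p : 'I_n => (p < i)%N)) /= [X in _ + X]big1 => [|p].
  rewrite addr0; apply: eq_bigl => p; rewrite -val_eqE /=; lia.
by rewrite -val_eqE /= => /andP[pi ip]; rewrite L2 ?mul0r //; lia.
Qed.

Lemma mulmx_lower_r R A i j : lower_unip R ->
  (A *m R) i j = A i j + \sum_(p : 'I_n | (j < p)%N) A i p * R p j.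
Proof.
move=> [L1 L2 _]; rewrite mxE (bigD1 j) //= L1 mulr1; congr (_ + _).
rewrite [LHS](bigID (fun p : 'I_n => (j < p)%N)) /= [X in _ + X]big1 => [|p].
  rewrite addr0; apply: eq_bigl => p; rewrite -val_eqE /=; lia.
by rewrite -val_eqE /= => /andP[pi ip]; rewrite L2 ?mulr0 //; lia.
Qed.

Lemma fresh_entry A B L R i j : lower_unip L -> lower_unip R ->
  (L *m A) i j = (B *m R) i j -> fresh A i j ->
  (forall p, (j < p)%N -> B i p * R p j = 0) -> A i j = B i j.
Proof.
move=> lL lR E /freshP fj BR; move: E.
rewrite mulmx_lower // mulmx_lower_r // !big1 ?addr0 // => p.
by move/fj ->; rewrite mulr0.
Qed.

Section Open.

Variables (comb : bool) (A B L R : 'M[F]_n) (i s k : 'I_n) (phi : 'cV[F]_n).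
Hypotheses (lL : lower_unip L) (lR : lower_unip R).
Hypothesis LABR : forall p j, allowed p j -> (L *m A) p j = (B *m R) p j.
Hypothesis AB : forall p, (p < i)%N -> row p A = row p B.
Hypothesis im : (i < m)%N.
Hypothesis of_phi : open_facts m A i s k phi.

Let supp_phi j : (j < m)%N -> phi j 0 = 0.
Proof. by case: of_phi => [[_ _ mk] [h _ _ _] _ _ _] jm; apply: h; lia. Qed.

Let LAphi p : (p <= i)%N -> row p (L *m A) *m phi = row p (B *m R) *m phi.
Proof.
move=> pi; apply/matrixP => a b; rewrite !mxE; apply: eq_bigr => j _.
rewrite (ord1 a) !row_entry; case: (ltnP j m) => jm; first by rewrite (ord1 b) supp_phi ?mulr0.
by congr (_ * _); apply: LABR; rewrite /in_pattern; lia.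
Qed.

Let LAphiE p : (p <= i)%N -> row p (L *m A) *m phi = row p A *m phi.
Proof.
move=> pi; apply/matrixP => a b; rewrite !ord1 -!row_mul !row_entry -mulmxA.
rewrite mulmx_lower // big1 ?addr0 // => q qp.
case: of_phi => [[i0 _ _] _ h8 _ _].
case: (posnP q) => q0; last first.
  have := h8 q; rewrite -row_mul => /(_ _)/matrixP/(_ 0 0); rewrite !mxE => -> //.
    by rewrite mulr0.
  by lia.
by case: lL => _ _ -> //; rewrite ?mul0r //; lia.
Qed.

Let psi := R *m phi - phi.

Let psi_rows p : (p < i)%N -> row p A *m psi = 0.
Proof.
move=> pi; rewrite mulmxBr mulmxA {1}AB // -row_mul -LAphi 1?ltnW //.
by rewrite LAphiE ?subrr // ltnW.
Qed.

Let psi_s : psi s 0 = 0.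
Proof.
case: of_phi => _ _ _ /submxP[w hw] _.
have : e s *m psi = 0.
  rewrite hw -mulmxA; suff -> : rows_between A 0 i *m psi = 0 by rewrite mulmx0.
  apply/row_matrixP => p; rewrite row_mul row_rows_between row0.
  by case: ifP => [/andP[_ /psi_rows]|]; rewrite ?mul0mx.
by rewrite mul_unit_row => /matrixP/(_ 0 0); rewrite !mxE mulr1n.
Qed.

Let psi_le j : (j <= k)%N -> psi j 0 = 0.
Proof.
case: of_phi => [[_ _ mk] [h _ _ _] _ _ _] jk.
rewrite /psi mxE mulmx_lower // big1 ?addr0 ?mxE ?addrK ?subrr // => q qj.
by rewrite h ?mulr0 //; lia.
Qed.

Lemma attached_functional :
  (forall j, j != s -> (k < j)%N -> B i j = 0) -> row i A *m phi = row i B *m phi.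
Proof.
move=> hB; have : row i (B *m R) *m phi = row i A *m phi by rewrite -LAphi ?LAphiE.
rewrite row_mul -mulmxA -[R *m phi](subrK phi) -/psi mulmxDr => <-.
rewrite -[RHS]add0r; congr (_ + _); apply/matrixP => a b.
rewrite !ord1 !mxE big1 // => j _; rewrite row_entry.
case: (eqVneq j s) => [->|js]; first by rewrite psi_s mulr0.
case: (leqP j k) => jk; first by rewrite psi_le ?mulr0.
by rewrite hB ?mul0r.
Qed.

Lemma attached_column j : fresh A i j -> (m <= j)%N -> R s j = 0.
Proof.
move=> /freshP fj mj; case: of_phi => _ _ _ /submxP[w hw] _.
have : (e s *m R) 0 j = R s j by rewrite -rowE mxE.
rewrite hw -mulmxA mxE big1 // => p _.
suff -> : (rows_between A 0 i *m R) p j = 0 by rewrite mulr0.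
rewrite -row_entry row_mul row_rows_between; case: ifP => [/= pi|]; last first.
  by rewrite mul0mx mxE.
rewrite AB // -row_mul row_entry -LABR; last by rewrite /in_pattern; lia.
rewrite mulmx_lower // fj // add0r big1 // => q qp.
by rewrite fj ?mulr0 //; lia.
Qed.

End Open.

Lemma row_stepP comb A i st y st' : row_step comb A i st y st' ->
  [\/ y = 0 /\ st' = st,
      exists j c, [/\ c != 0, fresh A i j, y = c *: e j
        & st' = if i == 0%N :> nat then Some (j, j) else st],
      exists s k c, [/\ st = Some (s, k), (i < m)%N, c != 0, y = c *: e s
        & st' = None]
    | exists s k j c c', [/\ st = Some (s, k) /\ (i < m)%N, c != 0 /\ c' != 0,
        fresh A i j /\ (m <= j < k)%N, y = c *: e s + c' *: e j
        & st' = Some (if comb then s else j, j)]].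
Proof.
case=> {st y st'}.
- by move=> st; constructor 1.
- move=> k c i0 c0; constructor 2; exists k, c; rewrite i0; split=> //.
  exact/freshP.
- move=> st j c i0 c0 fj; constructor 2; exists j, c; split=> //.
  by rewrite gtn_eqF.
- by move=> s k c im c0; constructor 3; exists s, k, c.
- by move=> s k j c c' im c0 c'0 fj mjk; constructor 4; exists s, k, j, c, c'.
Qed.

Definition row_transfer A i st (phi : 'cV[F]_n) (x y : 'rV[F]_n) :=
  [/\ forall c j, fresh A i j -> c != 0 -> y = c *: e j -> x 0 j = c,
      forall s k, st = Some (s, k) -> (i < m)%N ->
        (forall j, j != s -> (k < j)%N -> y 0 j = 0) -> x *m phi = y *m phi
    & forall s k c c' j, st = Some (s, k) -> (i < m)%N -> fresh A i j ->
        (m <= j)%N -> c' != 0 -> y = c *: e s + c' *: e j -> x 0 j = c'].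

Lemma row_transfer_equiv A B L R i st phi : pos_supported m B ->
  lower_unip L -> lower_unip R ->
  (forall p j, allowed p j -> (L *m A) p j = (B *m R) p j) ->
  (forall p, (p < i)%N -> row p A = row p B) ->
  (forall s k, st = Some (s, k) -> open_facts m A i s k phi) ->
  row_transfer A i st phi (row i A) (row i B).
Proof.
move=> sB lL lR E AB of_phi.
have posB j : row i B 0 j != 0 -> allowed i j by rewrite row_entry; apply: contraNT => /sB->.
split.
- move=> c j fj c0 yE.
  have yj : row i B 0 j = c by rewrite yE mxE unit_row_entry eqxx mulr1.
  have pj : allowed i j by apply: posB; rewrite yj.
  rewrite -[RHS]yj !row_entry; apply: (fresh_entry lL lR (E _ _ pj) fj) => p jp.
  by rewrite -row_entry yE mxE unit_row_entry -val_eqE /= gtn_eqF ?mulr0 ?mul0r.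
- move=> s k st_sk im hy.
  apply: (attached_functional lL lR E AB im (of_phi _ _ st_sk)) => j js kj.
  by rewrite -row_entry hy.
- move=> s k c c' j st_sk im fj mj c'0 yE.
  have ofp := of_phi _ _ st_sk.
  have js : j != s.
    apply: contraTneq fj => ->; case: ofp => _ [_ _ h6 h7] _ _ _.
    by apply: contraNN h6 => /h7->.
  have yj : row i B 0 j = c'.
    by rewrite yE !mxE !eqxx (negPf js) /= mulr0 add0r mulr1.
  have pj : allowed i j by apply: posB; rewrite yj.
  rewrite -[RHS]yj !row_entry; apply: (fresh_entry lL lR (E _ _ pj) fj) => p jp.
  rewrite -row_entry yE !mxE eqxx /=; case: (eqVneq p s) => [->|_].
    by rewrite (attached_column lL E AB im ofp fj mj) mulr0.
  have /negPf -> : p != j by apply: contraTneq jp => ->; rewrite ltnn.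
  by rewrite !mulr0 addr0 mul0r.
Qed.

Lemma row_step_unique comb A i st stx sty phi x y :
  (forall s k, st = Some (s, k) -> open_facts m A i s k phi) ->
  row_step comb A i st x stx -> row_step comb A i st y sty ->
  row_transfer A i st phi x y -> row_transfer A i st phi y x ->
  x = y /\ stx = sty.
Proof.
move=> of_phi /row_stepP sx /row_stepP sy txy tyx.
have off_s s k j : st = Some (s, k) -> fresh A i j ->
    [/\ j != s, phi j 0 = 0 & phi s 0 != 0].
  move=> /of_phi[_ [_ _ h6 h7] _ _ _] fj; split=> //; last exact: h7.
  by apply: contraNneq h6 => js; rewrite -js h7.
have flat z s k : st = Some (s, k) ->
    (z = 0 \/ exists j c, fresh A i j /\ z = c *: e j) -> (z *m phi) 0 0 = 0.
  move=> stE [->|[j [c [fj ->]]]]; first by rewrite mul0mx mxE.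
  have [_ pj _] := off_s s k j stE fj.
  by rewrite -scalemxAl mul_unit_row pj !mxE mulr1n mulr0.
have att (z w : 'rV[F]_n) s k c : st = Some (s, k) -> (i < m)%N -> 
    row_transfer A i st phi z w ->
    (w = c *: e s \/ exists j c', [/\ fresh A i j, (m <= j < k)%N
                                   & w = c *: e s + c' *: e j]) ->
    (z *m phi) 0 0 = c * phi s 0.
  move=> stE im [_ t2 _] wE; rewrite (t2 s k) //.
    case: wE => [->|[j [c' [fj mjk ->]]]].
      by rewrite -scalemxAl mul_unit_row !mxE mulr1n.
    have [_ pj _] := off_s s k j stE fj.
    by rewrite mulmxDl -!scalemxAl !mul_unit_row pj !mxE !mulr1n mulr0 addr0.
  move=> j js kj; case: wE => [->|[j' [c' [fj mjk ->]]]].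
    by rewrite mxE unit_row_entry (negPf js) mulr0.
  rewrite !mxE eqxx (negPf js) /=.
  have /negPf -> : j != j' by apply: contraTneq kj => ->; lia.
  by rewrite !mulr0 addr0.
have phis s k : st = Some (s, k) -> phi s 0 != 0.
  by move=> /of_phi[_ [_ _ h6 _] _ _ _].
have mixed (z w : 'rV[F]_n) s k c : st = Some (s, k) -> (i < m)%N -> c != 0 ->
    row_transfer A i st phi z w ->
    (w = c *: e s \/ exists j c', [/\ fresh A i j, (m <= j < k)%N
                                   & w = c *: e s + c' *: e j]) ->
    ~ (z = 0 \/ exists j c, fresh A i j /\ z = c *: e j).
  move=> stE im c0 tzw wE zE; have := att _ _ _ _ _ stE im tzw wE.
  move/esym/eqP; rewrite (flat _ _ _ stE zE) mulf_eq0 (negPf c0).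
  by rewrite (negPf (phis _ _ stE)).
have [txy1 _ txy3] := txy; have [tyx1 _ tyx3] := tyx.
case: sy => [[yE ->]|[j [c [c0 fj yE ->]]]|[s [k [c [stE im c0 yE ->]]]]|].
- case: sx => [[-> ->] //|[j [c [c0 fj xE _]]]|[s [k [c [stE im c0 xE _]]]]|].
  + by have := tyx1 _ _ fj c0 xE; rewrite yE mxE => c0'; rewrite -c0' eqxx in c0.
  + by case: (mixed _ _ _ _ _ stE im c0 tyx (or_introl xE)); left.
  + move=> [s [k [j [c [c' [[stE im] [c0 c'0] [fj mjk] xE _]]]]]].
    case: (mixed y x _ _ _ stE im c0 tyx); last by left.
    by right; exists j, c'.
- case: sx => [[xE _]|[j2 [c2 [c20 fj2 xE ->]]]|[s [k [c2 [stE im c20 xE _]]]]|].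
  + by have := txy1 _ _ fj c0 yE; rewrite xE mxE => c0'; rewrite -c0' eqxx in c0.
  + have := txy1 _ _ fj c0 yE; rewrite xE mxE unit_row_entry.
    case: (eqVneq j j2) => [<-|_]; first by rewrite mulr1 yE => ->.
    by rewrite mulr0 => c0'; rewrite -c0' eqxx in c0.
  + case: (mixed _ _ _ _ _ stE im c20 tyx (or_introl xE)).
    by right; exists j, c.
  + move=> [s [k [j2 [c2 [c' [[stE im] [c20 c'0] [fj2 mjk] xE _]]]]]].
    case: (mixed y x _ _ _ stE im c20 tyx); last by right; exists j, c.
    by right; exists j2, c'.
- have yE' : y = c *: e s \/ exists j c', [/\ fresh A i j, (m <= j < k)%N
                                   & y = c *: e s + c' *: e j] by left.
  have xphi := att _ _ _ _ _ stE im txy yE'.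
  case: sx => [[xE _]|[j2 [c2 [c20 fj2 xE _]]]|[s2 [k2 [c2 [stE2 im2 c20 xE ->]]]]|].
  + by case: (mixed _ _ _ _ _ stE im c0 txy yE'); left.
  + by case: (mixed _ _ _ _ _ stE im c0 txy yE'); right; exists j2, c2.
  + have [ss kk] : (s, k) = (s2, k2) by apply/Some_inj; rewrite -stE.
    have := xphi; rewrite xE -ss -scalemxAl mul_unit_row !mxE mulr1n.
    by move/(mulIf (phis _ _ stE)) => ->; rewrite yE.
  + move=> [s2 [k2 [j2 [c2 [c' [[stE2 _] [c20 c'0] [fj2 /andP[mj _]] xE _]]]]]].
    have [ss kk] : (s, k) = (s2, k2) by apply/Some_inj; rewrite -stE.
    have := tyx3 _ _ _ _ _ stE2 im fj2 mj c'0 xE.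
    have [/negPf js _ _] := off_s _ _ _ stE fj2.
    by rewrite yE mxE unit_row_entry js mulr0 => c0'; rewrite -c0' eqxx in c'0.
- move=> [s [k [j [c [c' [[stE im] [c0 c'0] [fj mjk] yE ->]]]]]].
  have yE' : y = c *: e s \/ exists j c', [/\ fresh A i j, (m <= j < k)%N
                                   & y = c *: e s + c' *: e j].
    by right; exists j, c'.
  have xphi := att _ _ _ _ _ stE im txy yE'.
  have [/negPf js pj _] := off_s _ _ _ stE fj; have /andP[mj jk] := mjk.
  have xj := txy3 _ _ _ _ _ stE im fj mj c'0 yE.
  case: sx => [[xE _]|[j2 [c2 [c20 fj2 xE _]]]|[s2 [k2 [c2 [stE2 im2 c20 xE ->]]]]|].
  + by case: (mixed _ _ _ _ _ stE im c0 txy yE'); left.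
  + by case: (mixed _ _ _ _ _ stE im c0 txy yE'); right; exists j2, c2.
  + have [ss kk] : (s, k) = (s2, k2) by apply/Some_inj; rewrite -stE.
    move: xj; rewrite xE mxE -ss unit_row_entry js mulr0 => c0'.
    by rewrite -c0' eqxx in c'0.
  + move=> [s2 [k2 [j2 [c2 [c2' [[stE2 _] [c20 c2'0] [fj2 mjk2] xE ->]]]]]].
    have [ss kk] : (s, k) = (s2, k2) by apply/Some_inj; rewrite -stE.
    have [/negPf js2 pj2 _] := off_s _ _ _ stE fj2.
    have := xphi; rewrite xE -ss mulmxDl -!scalemxAl !mul_unit_row pj2 !mxE !mulr1n.
    rewrite mulr0 addr0 => /(mulIf (phis _ _ stE)) c2E.
    move: xj; rewrite xE !mxE -ss eqxx js /= mulr0 add0r c2E.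
    case: (eqVneq j j2) => [<-|_]; first by rewrite mulr1 yE => ->.
    by rewrite mulr0 => c0'; rewrite -c0' eqxx in c'0.
Qed.

Theorem normal_rows_unique comb A B L R L' R' t stA stB :
  pos_supported m A -> pos_supported m B ->
  lower_unip L -> lower_unip R -> lower_unip L' -> lower_unip R' ->
  (forall p j, allowed p j -> (L *m A) p j = (B *m R) p j) ->
  (forall p j, allowed p j -> (L' *m B) p j = (A *m R') p j) ->
  normal_rows comb A t stA -> normal_rows comb B t stB ->
  stA = stB /\ (forall p, (p < t)%N -> row p A = row p B).
Proof.
move=> sA sB lL lR lL' lR' E E' nA; elim: nA stB => {t stA} [|i st stA nA IH stp] stB.
  by move=> nB; split=> //; inversion nB.
move et: i.+1 => t nB; case: nB et => // i2 st2 st2' nB stpB [/val_inj ii].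
rewrite -{}ii in nB stpB *.
have [stE AB] := IH _ nB; rewrite -{}stE in nB stpB.
have [phi of_phi] : exists phi, forall s k, st = Some (s, k) ->
    open_facts m A i s k phi.
  case: st nA {IH stp nB stpB} => [[s k]|] nA; last by exists 0.
  by have [phi h] := open_state_facts sA nA; exists phi => ? ? [<- <-].
have frAB j : fresh B i j = fresh A i j by apply/esym/fresh_eq.
have stpA' : row_step comb A i st (row i B) st2'.
  move: stpB; move: (row i B) => y; case=> {IH nA nB stp of_phi st y st2'}.
  + by move=> st; constructor.
  + by move=> k c i0 c0; constructor.
  + by move=> st j c; rewrite frAB => i0 c0 fj; constructor.
  + by move=> s k c im c0; constructor.
  + by move=> s k j c c'; rewrite frAB => im c0 c'0 fj mjk; constructor.
have tAB := row_transfer_equiv sB lL lR E AB of_phi.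
have tBA : row_transfer A i st phi (row i B) (row i A).
  have := @row_transfer_equiv B A L' R' i st phi sA lL' lR' E'.
  case=> [p pi|s k /of_phi[h1 [h4 h5 h6 h7] h8 h9 h10]|t1 t2 t3].
  + by rewrite AB.
  + have rAB lo : rows_between B lo i = rows_between A lo i.
      apply/row_matrixP => p; rewrite !row_rows_between.
      by case: ifP => // /andP[_ /AB].
    split; rewrite ?rAB //.
    * by split=> // j; rewrite frAB; apply: h7.
    * by move=> p p0; rewrite -AB ?h8 //; case/andP: p0.
    * by move=> j; rewrite frAB; apply: h10.
  + split=> [c j|//|s k c c' j st_sk im]; rewrite -frAB; [exact: t1|exact: (t3 _ _ _ _ _ st_sk im)].
have [rE ->] := row_step_unique of_phi stp stpA' tAB tBA.
split=> // p; rewrite ltnS leq_eqVlt => /orP[/eqP/val_inj->//|]; exact: AB.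
Qed.

End NormalFormUniqueness.

Section NormalFormExistence.

Variables (F : fieldType) (n m : nat).
Implicit Types (A B L R : 'M[F]_n) (i j p q s k : 'I_n) (st : option ('I_n * 'I_n)).

Local Notation e j := (delta_mx 0 j : 'rV[F]_n).
Local Notation allowed := (in_pattern m).
Local Notation row_step := (row_step m).
Local Notation normal_rows := (normal_rows m).

Variable Q : 'M[F]_n -> Prop.
Hypothesis Q_supported : forall A, Q A -> pos_supported m A.
Hypothesis Q_closed : forall A L R, Q A -> lower_unip m L -> lower_unip m R ->
  exists2 B, Q B & forall i j, allowed i j -> B i j = (L *m A *m R) i j.

Definition row_reachable A i (x : 'rV[F]_n) :=
  exists B, [/\ Q B, forall p, (p < i)%N -> row p B = row p A & row i B = x].

Lemma lower_unip_1 : lower_unip m (1%:M : 'M[F]_n).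
Proof.
split=> [i|i j ij|i j j0 i0]; rewrite mxE ?eqxx // -val_eqE /=.
  by rewrite ltn_eqF.
by rewrite j0 gtn_eqF //; case/andP: i0.
Qed.

Lemma move_reachable A i L R (x : 'rV[F]_n) : Q A ->
  lower_unip m L -> lower_unip m R ->
  (forall p j, (p < i)%N -> allowed p j -> (L *m A *m R) p j = A p j) ->
  (forall j, allowed i j -> (L *m A *m R) i j = x 0 j) ->
  (forall j, ~~ allowed i j -> x 0 j = 0) -> row_reachable A i x.
Proof.
move=> QA lL lR E1 E2 x0; have [B QB BE] := Q_closed QA lL lR.
exists B; split=> // [p pi|]; apply/rowP => j; rewrite !row_entry.
  case: (boolP (allowed p j)) => pj; first by rewrite BE // E1.
  by rewrite !(Q_supported _ pj).
case: (boolP (allowed i j)) => pj; first by rewrite BE // E2.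
by rewrite (Q_supported QB pj) x0.
Qed.

Lemma row_move A i lo (x : 'rV[F]_n) : Q A -> ((i < m)%N -> (0 < lo)%N) ->
  (x - row i A <= rows_between A lo i)%MS ->
  (forall j, ~~ allowed i j -> x 0 j = 0) -> row_reachable A i x.
Proof.
move=> QA ilo /submxP[w0 xE] x_supp.
pose w : 'rV[F]_n := \row_p (if (lo <= p < i)%N then w0 0 p else 0).
have wA : w *m A = x - row i A.
  rewrite xE; apply/rowP => j; rewrite !mxE; apply: eq_bigr => p _; rewrite !mxE.
  by case: ifP; rewrite ?mul0r ?mulr0.
have entry p q : ((e i)^T *m w) p q = (p == i)%:R * w 0 q.
  by rewrite mxE big_ord1 !mxE eqxx.
have lE : lower_unip m (1%:M + (e i)^T *m w).
  split=> [p|p q pq|p q q0 p0]; rewrite mxE entry mxE.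
  - rewrite eqxx mxE; case: eqP => [->|_]; last by rewrite mul0r addr0.
    by rewrite ltnn andbF mulr0 addr0.
  - rewrite -val_eqE /= ltn_eqF // add0r mxE; case: eqP => [pi|_]; last by rewrite mul0r.
    by rewrite ifF ?mulr0 // -pi; lia.
  - rewrite -val_eqE /= q0 gtn_eqF /= ?add0r; last by lia.
    rewrite mxE q0; case: eqP => [pi|_]; last by rewrite mul0r.
    by rewrite ifF ?mulr0 // -pi; move: ilo; rewrite -pi; lia.
have entryA p j : ((1%:M + (e i)^T *m w) *m A *m 1%:M) p j
      = A p j + (p == i)%:R * (x 0 j - A i j).
  rewrite mulmx1 mulmxDl mul1mx -mulmxA wA mxE; congr (_ + _).
  by rewrite mxE big_ord1 !mxE eqxx.
apply: (move_reachable QA lE lower_unip_1) => // [p j pi _|j _]; rewrite entryA.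
  by rewrite -val_eqE /= ltn_eqF // mul0r addr0.
by rewrite eqxx mul1r addrC subrK.
Qed.

Lemma column_move A i (phi : 'cV[F]_n) (v : 'rV[F]_n) : Q A ->
  (forall q j, phi q 0 != 0 -> v 0 j != 0 -> (j < q)%N) ->
  (forall j, v 0 j != 0 -> allowed i j) ->
  (forall p j, (p < i)%N -> allowed p j -> v 0 j != 0 -> row p A *m phi = 0) ->
  row_reachable A i (row i A + row i A *m phi *m v).
Proof.
move=> QA phi_v v_pos phi_A.
have entry p q : (phi *m v) p q = phi p 0 * v 0 q by rewrite mxE big_ord1.
have phi_v0 q j : (q <= j)%N -> phi q 0 * v 0 j = 0.
  move=> qj; case: (eqVneq (phi q 0) 0) => [->|p0]; first by rewrite mul0r.
  case: (eqVneq (v 0 j) 0) => [->|v0]; first by rewrite mulr0.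
  by have := phi_v _ _ p0 v0; lia.
have vpos0 j : ~~ allowed i j -> v 0 j = 0.
  by apply: contraNeq => /v_pos.
have lE : lower_unip m (1%:M + phi *m v).
  split=> [p|p q pq|p q q0 p0]; rewrite mxE entry mxE.
  - by rewrite eqxx phi_v0 // addr0.
  - by rewrite phi_v0 1?ltnW // -val_eqE /= ltn_eqF // addr0.
  - rewrite vpos0 ?mulr0 ?addr0; last by rewrite /in_pattern; lia.
    by rewrite -val_eqE /= q0 gtn_eqF //; lia.
have entryA p : row p (1%:M *m A *m (1%:M + phi *m v)) = row p A + row p A *m phi *m v.
  by rewrite mul1mx mulmxDr mulmx1 mulmxA raddfD /= !row_mul.
apply: (move_reachable QA lower_unip_1 lE) => [p j pi pj|j _|j pj].
- rewrite -[LHS]row_entry entryA mxE row_entry -[RHS]addr0; congr (_ + _).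
  case: (eqVneq (v 0 j) 0) => [vj|vj]; first by rewrite mxE big_ord1 vj mulr0.
  by rewrite (phi_A _ _ pi pj vj) mul0mx mxE.
- by rewrite -[LHS]row_entry entryA.
- by rewrite mxE row_entry (Q_supported QA) // mxE big_ord1 vpos0 // mulr0 addr0.
Qed.

Lemma normal_rows_eq comb A B t st : (forall p, (p < t)%N -> row p B = row p A) ->
  normal_rows comb A t st -> normal_rows comb B t st.
Proof.
move=> BA nA; elim: nA BA => {t st} [|i st st' _ IH stp] BA; first by constructor.
apply: (@NormalCons _ _ _ _ _ _ st).
  by apply: IH => p pi; apply: BA; apply: leqW.
rewrite BA //; move: (row i A) stp => x.
have fr j : fresh A i j -> fresh B i j.
  by rewrite (@fresh_eq _ _ A B) // => p pi; rewrite BA //; apply: leqW.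
case=> {IH st x st'}; try by constructor.
- by move=> st j c i0 c0 /fr; constructor.
- by move=> s k j c c' im c0 c'0 /fr; constructor.
Qed.

Definition next_normal comb A i := exists B st',
  [/\ Q B, forall p, (p < i)%N -> row p B = row p A & normal_rows comb B i.+1 st'].

Lemma last_nonzero (x : 'rV[F]_n) (P : pred 'I_n) :
  (forall j, P j -> x 0 j = 0) \/
  exists j, [/\ P j, x 0 j != 0 & forall j', P j' -> (j < j')%N -> x 0 j' = 0].
Proof.
case: (pickP [pred j | P j && (x 0 j != 0)]) => [j0 Pj0|h]; last first.
  by left=> j Pj; have := h j; rewrite /= Pj /= => /negbFE/eqP.
right; case: (@arg_maxnP _ j0 [pred j | P j && (x 0 j != 0)] val Pj0) => j.
move=> /andP[Pj xj] jmax; exists j; split=> // j' Pj' jj'.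
apply/eqP/contraT => xj'; have := jmax j'; rewrite /= Pj' xj' => /(_ isT) /=.
by rewrite leqNgt jj'.
Qed.

Lemma row_step_eq comb A B i st x st' : (forall p, (p < i)%N -> row p B = row p A) ->
  row_step comb A i st x st' -> row_step comb B i st x st'.
Proof.
move=> BA; have fr j : fresh A i j -> fresh B i j.
  by rewrite (@fresh_eq _ _ A B) // => p pi; rewrite BA.
case=> {st x st'}; try by constructor.
- by move=> st j c i0 c0 /fr; constructor.
- by move=> s k j c c' im c0 c'0 /fr; constructor.
Qed.

Lemma reduce_stale_columns A i lo (z : 'rV[F]_n) : Q A -> ((i < m)%N -> (0 < lo)%N) ->
  (forall j, z 0 j != 0 -> allowed i j && ~~ fresh A i j) ->
  (forall j, ~~ fresh A i j ->
     exists a, (e j - a *: z <= rows_between A lo i)%MS) ->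
  exists B, [/\ Q B, forall p, (p < i)%N -> row p B = row p A
    & forall j, ~~ fresh A i j -> z 0 j = 0 -> B i j = 0].
Proof.
move=> QA ilo zE h.
have [a ha] : exists a : 'I_n -> F, forall j,
    fresh A i j \/ (e j - a j *: z <= rows_between A lo i)%MS.
  apply: (@fin_all_exists _ (fun _ => F) (fun j a => fresh A i j \/
    (e j - a *: z <= rows_between A lo i)%MS)) => j; case: (boolP (fresh A i j)) => [|/h[a ?]].
    by exists 0; left.
  by exists a; right.
pose x := row i A - \sum_(j | ~~ fresh A i j) A i j *: (e j - a j *: z).
have xE j : z 0 j = 0 -> x 0 j = if fresh A i j then A i j else 0.
  move=> zj; rewrite !mxE summxE.
  rewrite [X in - X](_ : _ = \sum_(j' | ~~ fresh A i j' && (j' == j)) A i j'); last first.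
    rewrite [RHS]big_mkcondr; apply: eq_bigr => j' _; rewrite !mxE zj mulr0 subr0 eqxx eq_sym.
    by case: eqP; rewrite ?mulr1 ?mulr0.
  case: (boolP (fresh A i j)) => fj.
    rewrite big1 ?subr0 // => j' /andP[fj' /eqP jj].
    by rewrite jj fj in fj'.
  by rewrite (big_pred1 j) ?subrr // => j'; rewrite /= andbC; case: eqP => // ->.
have [B [QB BA BE]] : row_reachable A i x.
  apply: (row_move QA ilo) => [|j pj].
    rewrite addrAC subrr add0r eqmx_opp; apply: summx_sub => j fj.
    by apply: scalemx_sub; case: (ha j) => //; rewrite (negPf fj).
  rewrite xE; first by rewrite (Q_supported QA pj) if_same.
  by apply/eqP/contraT => /zE; rewrite (negPf pj).
exists B; split=> // j fj zj; rewrite -row_entry BE xE //; by rewrite (negPf fj).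
Qed.

Lemma next_of_last comb A i st j : Q A -> normal_rows comb A i st ->
  fresh A i j -> A i j != 0 -> (forall j', (j < j')%N -> A i j' = 0) ->
  next_normal comb A i.
Proof.
move=> QA nA fj Aij Alast.
pose c := A i j.
have [B [QB BA BE]] : row_reachable A i (c *: e j).
  have := @column_move A i (e j)^T (- c^-1 *: (row i A - c *: e j)) QA.
  set v := - c^-1 *: _ => col.
  have vE j' : v 0 j' = - c^-1 * (A i j' - c * (j' == j)%:R).
    by rewrite !mxE eqxx.
  have vj' j' : v 0 j' != 0 -> (j' != j) && (A i j' != 0).
    rewrite vE; case: (eqVneq j' j) => [->|_]; first by rewrite mulr1 subrr mulr0 eqxx.
    by rewrite mulr0 subr0 /=; apply: contraNneq => ->; rewrite mulr0.
  have rphi p : row p A *m (e j)^T = (A p j)%:M.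
    by rewrite trmx_delta -colE; apply/matrixP => a b; rewrite !ord1 !mxE mulr1n.
  move: col; rewrite rphi mul_scalar_mx scalerA mulrN mulfV // scaleN1r addrC opprB subrK.
  apply.
  - move=> q j' + /vj' /andP[j'j Aj']; rewrite !mxE eqxx.
    case: (eqVneq q j) => [-> _|_]; last by rewrite eqxx.
    rewrite ltn_neqAle (val_eqE j') j'j leqNgt.
    by apply: contraNN Aj' => /Alast ->.
  - move=> j' /vj' /andP[_]; by apply: contraNT => /(Q_supported QA) ->.
  - move=> p j' pi _ _; rewrite rphi; move/freshP: fj => -> //; exact: raddf0.
have nB : normal_rows comb B i st by apply: normal_rows_eq nA.
have stp : row_step comb B i st (row i B) (if i == 0%N :> nat then Some (j, j) else st).
  rewrite BE; apply: (row_step_eq BA).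
  case: (posnP i) => i0; last by constructor.
  move: nA; rewrite i0 => nA.
  by inversion nA; constructor.
exists B, (if i == 0%N :> nat then Some (j, j) else st); split=> //.
exact: NormalCons nB stp.
Qed.

Lemma next_of_fresh comb A i st : Q A -> normal_rows comb A i st ->
  (forall j, ~~ fresh A i j -> A i j = 0) -> next_normal comb A i.
Proof.
move=> QA nA h; case: (last_nonzero (row i A) predT) => [z|[j [_ Aij jmax]]].
  exists A, st; split=> //; apply: (NormalCons nA).
  have -> : row i A = 0 by apply/rowP => j; rewrite z // mxE.
  by constructor.
rewrite row_entry in Aij.
have fj : fresh A i j by apply: contraNT Aij => /h ->.
by apply: (next_of_last QA nA fj Aij) => j' /(jmax _ isT); rewrite row_entry.
Qed.

Lemma next_of_next comb A B i : (forall p, (p < i)%N -> row p B = row p A) ->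
  next_normal comb B i -> next_normal comb A i.
Proof.
move=> BA [C [st [QC CB nC]]]; exists C, st; split=> // p pi.
by rewrite CB ?BA.
Qed.

Lemma next_of_attached comb A i s k : Q A -> (i < m)%N ->
  normal_rows comb A i (Some (s, k)) -> A i s != 0 ->
  (forall j, ~~ fresh A i j -> j != s -> A i j = 0) -> next_normal comb A i.
Proof.
move=> QA im nA Ais h; have sA := Q_supported QA.
have [phi [[i0 ms mk] [h4 h5 h6 h7] h8 h9 h10]] := open_state_facts sA nA.
have pos_ge j : (m <= j)%N -> allowed i j by rewrite /in_pattern; lia.
have fr0 j : j != s -> A i j != 0 -> fresh A i j.
  by move=> js; apply: contraNT => fj; rewrite h.
case: (last_nonzero (row i A) [pred j | (j != s) && (k < j)%N]) => [zk|].
  pose c := A i s.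
  case: (last_nonzero (row i A) [pred j | (j != s) && (m <= j)%N]) => [zm|].
    have [B [QB BA BE]] : row_reachable A i (c *: e s).
      pose v := - (c * phi s 0)^-1 *: (row i A - c *: e s).
      have vE j : v 0 j = - (c * phi s 0)^-1 * (A i j - c * (j == s)%:R).
        by rewrite !mxE eqxx.
      have vj j : v 0 j != 0 -> [/\ j != s, A i j != 0 & (j < m)%N].
        rewrite vE; case: (eqVneq j s) => [->|js].
          by rewrite mulr1 subrr mulr0 eqxx.
        rewrite mulr0 subr0 => nz; have Aij : A i j != 0.
          by apply: contraNneq nz => ->; rewrite mulr0.
        split=> //; rewrite ltnNge; apply: contraNN Aij => mj.
        by rewrite -row_entry zm //= js mj.
      have rphi : row i A *m phi = (c * phi s 0)%:M.
        apply/matrixP => a b; rewrite !ord1 !mxE mulr1n (bigD1 s) //= row_entry.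
        rewrite big1 ?addr0 // => j js; case: (ltnP j m) => jm.
          by rewrite h4 ?mulr0 //; lia.
        by rewrite zm ?mul0r //= js jm.
      have := @column_move A i phi v QA; rewrite rphi mul_scalar_mx scalerA.
      rewrite mulrN mulfV ?mulf_neq0 // scaleN1r opprB addrC subrK; apply.
      - move=> q j + /vj[_ _ jm]; apply: contraNltn => qj; rewrite h4 //; lia.
      - by move=> j /vj[_ Aij _]; apply: contraNT Aij => /sA ->.
      - move=> p j pi + /vj[_ _ jm]; rewrite /in_pattern => pj.
        by apply: h8; lia.
    exists B, None; split=> //; apply: NormalCons (normal_rows_eq BA nA) _.
    by rewrite BE; apply: (row_step_eq BA); constructor.
  move=> [j [/= /andP[js mj] Aij jmax]]; pose c' := A i j.
  rewrite row_entry in Aij; have fj := fr0 _ js Aij.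
  have jk : (j < k)%N.
    rewrite ltn_neqAle; apply/andP; split.
      by apply: contraTneq fj => /val_inj ->; apply: contraNN h5 => /h7 ->.
    by rewrite leqNgt; apply: contraNN Aij => kj; rewrite -row_entry zk //= js.
  have [B [QB BA BE]] : row_reachable A i (c *: e s + c' *: e j).
    pose v := - c'^-1 *: (row i A - (c *: e s + c' *: e j)).
    have vE j' : v 0 j' = - c'^-1 * (A i j' - (c * (j' == s)%:R + c' * (j' == j)%:R)).
      by rewrite !mxE eqxx.
    have vj j' : v 0 j' != 0 -> A i j' != 0 /\ (j' < j)%N.
      rewrite vE; case: (eqVneq j' s) => [->|j's].
        by rewrite [s == j]eq_sym (negPf js) mulr0 addr0 mulr1 subrr mulr0 eqxx.
      case: (eqVneq j' j) => [->|j'j].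
        by rewrite mulr0 add0r mulr1 subrr mulr0 eqxx.
      rewrite !mulr0 addr0 subr0 => nz; have Aij' : A i j' != 0.
        by apply: contraNneq nz => ->; rewrite mulr0.
      split=> //; rewrite ltn_neqAle (val_eqE j') j'j leqNgt.
      apply: contraNN Aij' => jj'; rewrite -row_entry jmax //= j's; lia.
    have rphi p : row p A *m (e j)^T = (A p j)%:M.
      by rewrite trmx_delta -colE; apply/matrixP => a b; rewrite !ord1 !mxE mulr1n.
    have := @column_move A i (e j)^T v QA; rewrite rphi mul_scalar_mx scalerA.
    rewrite mulrN mulfV // scaleN1r opprB addrC subrK; apply.
    - move=> q j' + /vj[_ jj']; rewrite !mxE eqxx.
      by case: (eqVneq q j) => [-> //|_]; rewrite eqxx.
    - by move=> j' /vj[Aij' _]; apply: contraNT Aij' => /sA ->.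
    - by move=> p j' pi _ _; rewrite rphi; move/freshP: fj => -> //; exact: raddf0.
  exists B, (Some (if comb then s else j, j)); split=> //.
  apply: NormalCons (normal_rows_eq BA nA) _.
  by rewrite BE; apply: (row_step_eq BA); constructor; rewrite ?mj.
move=> [j [/= /andP[js kj] Aij jmax]]; rewrite row_entry in Aij.
have fj := fr0 _ js Aij.
have nfk : ~~ fresh A i k by apply: contraNN h5 => /h7 ->.
(* modulo the previous rows, the entry at s may be moved to column k < j *)
have [a ha] := h10 k nfk.
have a0 : a != 0.
  have phi0 : (e k - a *: e s) *m phi = 0.
    have /submxP[w ->] := ha; rewrite -mulmxA.
    suff -> : rows_between A 1 i *m phi = 0 by rewrite mulmx0.
    apply/row_matrixP => p; rewrite row_mul row_rows_between row0.
    by case: ifP => [/h8|]; rewrite ?mul0mx.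
  apply: contraNneq h5 => a0; move: phi0.
  by rewrite a0 scale0r subr0 mul_unit_row => /matrixP/(_ 0 0); rewrite !mxE mulr1n => ->.
pose c := A i s.
have [B [QB BA BE]] : row_reachable A i (row i A + (c / a) *: (e k - a *: e s)).
  apply: (row_move QA (lo := 1)) => //.
    by rewrite addrAC subrr add0r scalemx_sub.
  move=> j' pj'; have neq q : (m <= q)%N -> j' == q = false.
    by move=> mq; apply/negP => /eqP jq; move: pj'; rewrite jq pos_ge.
  by rewrite !mxE sA // !neq // andbF mulr0 subr0 mulr0 addr0.
have Bij j' : B i j' = A i j' + (c / a) * ((j' == k)%:R - a * (j' == s)%:R).
  by rewrite -row_entry BE !mxE eqxx.
have jk : j != k by apply: contraTneq kj => ->; rewrite ltnn.
apply: (next_of_next BA); apply: (@next_of_last comb _ _ (Some (s, k)) j QB (normal_rows_eq BA nA)).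
- by rewrite (@fresh_eq _ _ B A).
- by rewrite Bij (negPf jk) (negPf js) mulr0 subr0 mulr0 addr0.
move=> j' jj'; rewrite Bij.
have /negPf -> : j' != k by apply: contraTneq jj' => ->; lia.
case: (eqVneq j' s) => [->|j's].
  by rewrite mulr1 sub0r mulrN divfK // subrr.
by rewrite -row_entry jmax ?j's // ?mulr0 ?subr0 ?mulr0 ?addr0 //=; lia.
Qed.

Theorem normal_rows_exist comb A : Q A -> exists B st, Q B /\ normal_rows comb B n st.
Proof.
move=> QA; suff : forall t, (t <= n)%N ->
    exists B st, Q B /\ normal_rows comb B t st by apply.
elim=> [_|t IH tn]; first by exists A, None; split=> //; constructor.
have [B [st [QB nB]]] := IH (ltnW tn).
pose i := Ordinal tn; have {}nB : normal_rows comb B i st := nB.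
suff [C [st' [QC _ nC]]] : next_normal comb B i by exists C, st'.
have sB := Q_supported QB.
case: (posnP i) => i0.
  apply: (next_of_fresh QB nB) => j /negP[]; apply/freshP => p; rewrite i0; lia.
have := normal_rows_facts sB nB.
case: st nB => [[s k]|] nB /= facts; last first.
  have h0 : (i < m)%N -> (0 < 1)%N by [].
  have [|j|C [QC CB C0]] := reduce_stale_columns (z := 0) QB h0.
  + by move=> j; rewrite mxE eqxx.
  + by move=> /facts; exists 0; rewrite scale0r subr0.
  apply: (next_of_next CB); apply: (next_of_fresh QC (normal_rows_eq CB nB)) => j.
  by rewrite (@fresh_eq _ _ C B) // => fj; rewrite C0 // mxE.
have [phi [[_ ms mk] [h4 h5 h6 h7] h8 h9 h10]] := facts.
case: (leqP m i) => im.
  have h0 : (i < m)%N -> (0 < 0)%N by rewrite ltnNge im.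
  have [|j|C [QC CB C0]] := reduce_stale_columns (z := 0) QB h0.
  + by move=> j; rewrite mxE eqxx.
  + move=> /h10[a ha]; exists 0; rewrite scale0r subr0 -[e j](subrK (a *: e s)).
    rewrite addmx_sub ?scalemx_sub //; apply: submx_trans ha _.
    exact: rows_between_mono.
  apply: (next_of_next CB); apply: (next_of_fresh QC (normal_rows_eq CB nB)) => j.
  by rewrite (@fresh_eq _ _ C B) // => fj; rewrite C0 // mxE.
have h0 : (i < m)%N -> (0 < 1)%N by [].
have nfs : ~~ fresh B i s by apply: contraNN h6 => /h7 ->.
have [|j|C [QC CB C0]] := reduce_stale_columns (z := e s) QB h0.
+ move=> j; rewrite unit_row_entry; case: (eqVneq j s) => [->|_]; last by rewrite eqxx.
  by rewrite /in_pattern /= in ms im i0 *; rewrite nfs andbT; lia.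
+ exact: h10.
have frC j : fresh C i j = fresh B i j by apply: fresh_eq.
apply: (next_of_next CB); have nC := normal_rows_eq CB nB.
have C0' j : ~~ fresh C i j -> j != s -> C i j = 0.
  by rewrite frC => fj /negPf js; rewrite C0 // unit_row_entry js.
case: (eqVneq (C i s) 0) => [Cis|Cis]; last exact: (next_of_attached QC im nC Cis).
apply: (next_of_fresh QC nC) => j fj; case: (eqVneq j s) => [-> //|]; exact: C0'.
Qed.

End NormalFormExistence.

Section Representatives.

Variables (F : finFieldType) (n m : nat) (comb : bool).
Implicit Types (A : 'M[F]_n) (p q : 'I_n * 'I_n) (r : nat) (k i : nat -> nat).

Local Notation e j := (delta_mx 0 j : 'rV[F]_n).

Definition attach_index k (d : nat) := if comb then k 1%N else k d.

Definition chain_vertex r (r' : nat) k i p : Prop :=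
  [\/ (p.1.+1, p.2.+1) = (1, k 1)%N,
      exists2 d, (1 <= d <= r')%N & (p.1.+1, p.2.+1) = (i d, attach_index k d)
    | exists2 d, (1 <= d <= r.-1)%N & (p.1.+1, p.2.+1) = (i d, k d.+1)].

Definition chain_shape (S : {set 'I_n * 'I_n}) : Prop :=
  exists (r r' : nat) (k i : nat -> nat), index_chain n m r r' k i /\
    forall p, p \in S <-> chain_vertex r r' k i p.

Definition chain_representative A : Prop :=
  (#|big_components A| <= 1)%N /\
  forall S, S \in big_components A -> chain_shape S.

Definition isolated A (t : nat) p := forall q,
  (q.1 < t)%N -> A q.1 q.2 != 0 -> q != p -> q.1 <> p.1 /\ q.2 <> p.2.

Definition chained A (t : nat) r (r' : nat) k i : Prop :=
  [/\ index_chain n m r r' k i,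
      forall p, chain_vertex r r' k i p -> (p.1 < t)%N,
      forall p, chain_vertex r r' k i p -> A p.1 p.2 != 0
    & forall p, (p.1 < t)%N -> A p.1 p.2 != 0 -> ~ chain_vertex r r' k i p ->
        isolated A t p].

Definition rook A (t : nat) :=
  forall p, (p.1 < t)%N -> A p.1 p.2 != 0 -> isolated A t p.

Lemma entry_connect_sym A : connect_sym (entry_edge A).
Proof.
apply: sym_connect_sym => p q; rewrite /entry_edge eq_sym.
by rewrite [p.1 == _]eq_sym [p.2 == _]eq_sym andbCA.
Qed.

Lemma connect_entry_vertices A p q :
  connect (entry_edge A) p q -> p \in entry_vertices A -> q \in entry_vertices A.
Proof.
move=> /connectP[s ps ->]; elim: s p ps => //= q' s IH p /andP[pq' q's] _.
by apply: IH q's _; case/and4P: pq'.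
Qed.

Lemma connect_isolated A p q :
  connect (entry_edge A) p q -> isolated A n p -> q = p.
Proof.
move=> /connectP[[|q' s] /=]; first by move=> _ ->.
move=> /andP[/and4P[_ q'V pq' pq'e] _] _ iso.
have [//||n1 n2] := iso q' (ltn_ord _); first by move: q'V; rewrite inE.
  by rewrite eq_sym.
by case/orP: pq'e => /eqP h; [case: n1 | case: n2].
Qed.

Lemma small_component_isolated A p : A p.1 p.2 != 0 ->
  [set q | connect (entry_edge A) p q] \notin big_components A -> isolated A n p.
Proof.
move=> Ap big q _ Aq qp; suff : ~ ((p.1 == q.1) || (p.2 == q.2)).
  by move=> h; split=> pq; apply: h; rewrite pq eqxx ?orbT.
move=> pq; case/negP: big; rewrite inE; apply/andP; split.
  by apply/imsetP; exists p; rewrite ?inE.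
apply/card_gt1P; exists p, q; rewrite !inE connect0 eq_sym qp; split=> //.
by apply: connect1; rewrite /entry_edge !inE Ap Aq eq_sym qp pq.
Qed.

Lemma big_component_spec A S : S \in big_components A -> exists p,
  [/\ A p.1 p.2 != 0, S = [set q | connect (entry_edge A) p q] & ~ isolated A n p].
Proof.
rewrite inE => /andP[/imsetP[p]]; rewrite inE => Ap -> /card_gt1P[q [q' []]].
rewrite !inE => pq pq' qq'; exists p; split=> // iso.
by move: qq'; rewrite (connect_isolated pq iso) (connect_isolated pq' iso) eqxx.
Qed.

Lemma ord_succ (x : nat) : (0 < x <= n)%N -> exists j : 'I_n, j.+1 = x.
Proof.
move=> h; have h' : (x.-1 < n)%N by lia.
by exists (Ordinal h') => /=; lia.
Qed.

Lemma pair_ord p q : (p.1.+1, p.2.+1) = (q.1.+1, q.2.+1) -> p = q.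
Proof. by case: p q => [a b] [c d] /= [/val_inj -> /val_inj ->]. Qed.

Lemma chain_vertices_connected A r (r' : nat) k i : (m < n)%N ->
  index_chain n m r r' k i ->
  (forall p, chain_vertex r r' k i p -> A p.1 p.2 != 0) ->
  forall p q, chain_vertex r r' k i p -> chain_vertex r r' k i q ->
  connect (entry_edge A) p q.
Proof.
move=> mn [[r1 rr'] kb kd ib id_] Anz.
have edge p q : chain_vertex r r' k i p -> chain_vertex r r' k i q ->
    p.1 = q.1 \/ p.2 = q.2 -> connect (entry_edge A) p q.
  move=> cp cq pq; case: (eqVneq p q) => [->|npq]; first exact: connect0.
  apply: connect1; rewrite /entry_edge !inE !Anz // npq /=.
  by case: pq => ->; rewrite eqxx ?orbT.
have [k1 k1E] := ord_succ (x := k 1%N) ltac:(have := kb 1%N; lia).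
have [o oE] := ord_succ (x := 1) ltac:(lia).
pose root := (o, k1).
have croot : chain_vertex r r' k i root by constructor 1; rewrite /= oE k1E.
have cattach d p : (1 <= d <= r')%N -> (p.1.+1, p.2.+1) = (i d, attach_index k d) ->
    connect (entry_edge A) p root.
  elim: d p => // d IH p dr pE.
  have cp : chain_vertex r r' k i p by constructor 2; exists d.+1.
  have [kE|[cb d0]] : attach_index k d.+1 = k 1%N \/ comb = false /\ (0 < d)%N.
    by rewrite /attach_index; case: (comb); [left | case: (d); [left | right]].
    apply: edge => //; right; apply: val_inj => /=.
    by move: pE; rewrite kE -k1E => -[_ []].
  have [id1 id1E] := ord_succ (x := i d) ltac:(have := ib d; lia).
  have [kd1 kd1E] := ord_succ (x := attach_index k d)
    ltac:(rewrite /attach_index cb; have := kb d; lia).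
  have c1 : chain_vertex r r' k i (id1, kd1).
    by constructor 2; exists d; rewrite /= ?id1E ?kd1E //; lia.
  have c2 : chain_vertex r r' k i (id1, p.2).
    constructor 3; exists d; rewrite /= ?id1E; first by lia.
    by move: pE; rewrite /attach_index cb => -[_ ->].
  apply: connect_trans (edge _ _ cp c2 (or_intror erefl)) _.
  apply: connect_trans (edge _ _ c2 c1 (or_introl erefl)) _.
  by apply: IH; rewrite /= ?id1E ?kd1E //; lia.
suff all_root p : chain_vertex r r' k i p -> connect (entry_edge A) p root.
  move=> p q /all_root pr /all_root qr; apply: connect_trans pr _.
  by rewrite entry_connect_sym.
move=> cp; case: (cp) => [pE|[d dr pE]|[d dr pE]].
- suff -> : p = root by exact: connect0.
  by apply: pair_ord; rewrite pE /= oE k1E.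
- exact: cattach pE.
- have [kd1 kd1E] := ord_succ (x := attach_index k d)
    ltac:(rewrite /attach_index; case: (comb); [have := kb 1%N | have := kb d]; lia).
  have pE' : (p.1.+1, kd1.+1) = (i d, attach_index k d).
    by rewrite kd1E; case: pE => ->.
  have dr' : (1 <= d <= r')%N by lia.
  have c1 : chain_vertex r r' k i (p.1, kd1) by constructor 2; exists d.
  apply: connect_trans (edge _ _ cp c1 (or_introl erefl)) _.
  exact: (cattach d (p.1, kd1)).
Qed.

Lemma rook_representative A : rook A n -> chain_representative A.
Proof.
move=> rA; suff big0 S : S \notin big_components A.
  split=> [|S SA]; last by rewrite (negPf (big0 S)) in SA.
  rewrite (_ : big_components A = set0) ?cards0 //.
  by apply/setP => S; rewrite (negPf (big0 S)) in_set0.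
apply/negP => /big_component_spec[p [Ap _ []]].
exact: rA.
Qed.

Lemma chained_representative A r (r' : nat) k i : (m < n)%N ->
  chained A n r r' k i -> chain_representative A.
Proof.
move=> mn [ch _ cA cI].
have spec S : S \in big_components A -> forall p, p \in S <-> chain_vertex r r' k i p.
  move=> /big_component_spec[p [Ap -> niso]].
  have cp : chain_vertex r r' k i p.
    by case: (boolp.EM (chain_vertex r r' k i p)) => // h; case: niso; apply: cI.
  move=> q; rewrite inE; split=> [pq|cq]; last first.
    exact: (chain_vertices_connected mn ch cA).
  case: (boolp.EM (chain_vertex r r' k i q)) => // h; case: niso.
  have Aq : A q.1 q.2 != 0.
    by have := connect_entry_vertices pq; rewrite !inE; apply.
  have iso := cI q (ltn_ord _) Aq h.
  by rewrite (connect_isolated (p := q) (q := p) _ iso) // entry_connect_sym.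
split=> [|S /spec SE]; last by exists r, r', k, i.
apply/card_le1_eqP => S S' /spec SE /spec SE'; apply/setP => p.
by apply/idP/idP => h; [apply/SE/SE' | apply/SE'/SE].
Qed.

Lemma representative_chained A : (0 < n)%N -> pos_supported m A -> chain_representative A ->
  rook A n /\ (forall p, p.1 = 0%N :> nat -> A p.1 p.2 = 0) \/
  exists r (r' : nat) k i, chained A n r r' k i.
Proof.
move=> n0 sA [c1 c2]; case: (set_0Vmem (big_components A)) => [b0|[S SA]].
  have rA : rook A n.
    by move=> p _ Ap; apply: small_component_isolated; rewrite // b0 inE.
  case: (boolp.EM (exists p, p.1 = 0%N :> nat /\ A p.1 p.2 != 0)); last first.
    move=> h; left; split=> // p p0; apply/eqP/contraT => Ap.
    by case: h; exists p.
  move=> [p [p0 Ap]]; right; exists 1%N, 0%N, (fun=> p.2.+1), (fun=> 0%N).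
  have cp q : chain_vertex 1 0 (fun=> p.2.+1) (fun=> 0%N) q <-> q = p.
    split=> [[qE|[d]|[d]]|->]; try lia; last by constructor 1; rewrite p0.
    by apply: pair_ord; rewrite p0.
  have pp : in_pattern m p.1 p.2 by apply: contraNT Ap => /sA ->.
  split=> [|q _|q /cp-> //|q _ Aq _]; last exact: rA.
    split; try lia.
    move=> d _; move: pp; rewrite /in_pattern p0 /=; have := ltn_ord p.2; lia.
  exact: ltn_ord.
right; have [r [r' [k [i [ch SE]]]]] := c2 _ SA; exists r, r', k, i.
have [p [Ap SE' _]] := big_component_spec SA.
split=> // [q /(proj2 (SE _))|q _ Aq nq].
  rewrite SE' inE => pq.
  by have := connect_entry_vertices pq; rewrite !inE; apply.
apply: small_component_isolated => //; apply/negP => big.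
apply: nq; apply/SE; have /card_le1_eqP/(_ _ _ big SA) -> := c1.
by rewrite inE connect0.
Qed.

Definition plain_row A (t : 'I_n) :=
  (forall j, A t j != 0 -> fresh A t j) /\
  (forall j j', A t j != 0 -> A t j' != 0 -> j = j').

Lemma isolated_grow A (t : 'I_n) p : (p.1 < t)%N -> isolated A t p ->
  (forall j, A t j != 0 -> j <> p.2) -> isolated A t.+1 p.
Proof.
move=> pt iso hj q qt Aq qp; case: (ltnP q.1 t) => qt'; first exact: iso.
have qE : q.1 = t by apply: val_inj => /=; lia.
split; last by apply: hj; rewrite -qE.
by rewrite qE => tp; rewrite tp ltnn in pt.
Qed.

Lemma fresh_other_column A (t : 'I_n) p j :
  (p.1 < t)%N -> A p.1 p.2 != 0 -> fresh A t j -> j <> p.2.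
Proof. by move=> pt Ap /freshP fj jE; rewrite -jE fj ?eqxx in Ap. Qed.

Lemma plain_isolated A (t : 'I_n) p : plain_row A t -> p.1 = t -> A p.1 p.2 != 0 ->
  isolated A t.+1 p.
Proof.
case: p => p1 j /= [fr one] -> Atj [q1 q2] /= qt Aq qp.
case: (eqVneq q1 t) => [qE|qE].
  by case/eqP: qp; rewrite qE in Aq *; rewrite (one _ _ Aq Atj).
split=> [/eqP|q2j]; first by rewrite (negPf qE).
have q1t : (q1 < t)%N by rewrite ltn_neqAle (val_eqE q1) qE -ltnS.
by have /freshP/(_ q1 q1t)/eqP := fr _ Atj; rewrite -q2j (negPf Aq).
Qed.

Lemma plain_isolated_grow A (t : 'I_n) p : plain_row A t -> (p.1 < t)%N ->
  A p.1 p.2 != 0 -> isolated A t p -> isolated A t.+1 p.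
Proof.
move=> [fr _] pt Ap iso; apply: isolated_grow => // j /fr.
exact: fresh_other_column.
Qed.

Lemma rook_grow A (t : 'I_n) : plain_row A t -> rook A t -> rook A t.+1.
Proof.
move=> pl rA p pt Ap; case: (ltnP p.1 t) => pt'.
  by apply: plain_isolated_grow => //; apply: rA.
by apply: plain_isolated => //; apply: val_inj => /=; lia.
Qed.

Lemma chained_grow A (t : 'I_n) r (r' : nat) k i : plain_row A t ->
  chained A t r r' k i -> chained A t.+1 r r' k i.
Proof.
move=> pl [c1 c2 c3 c4]; split=> // [p /c2|p pt Ap np]; first exact: leqW.
case: (ltnP p.1 t) => pt'; last first.
  by apply: plain_isolated => //; apply: val_inj => /=; lia.
by apply: plain_isolated_grow => //; apply: c4.
Qed.

Lemma chained_bound A t r (r' : nat) k i d : chained A t r r' k i -> (m < n)%N ->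
  (1 <= d <= r')%N -> (i d <= t)%N.
Proof.
move=> [[[r1 rr'] kb kd ib id_] c2 _ _] mn dr.
have [p1 p1E] := ord_succ (x := i d) ltac:(have := ib d; lia).
have [p2 p2E] := ord_succ (x := attach_index k d)
    ltac:(rewrite /attach_index; case: (comb); [have := kb 1%N | have := kb d]; lia).
by rewrite -p1E; apply: (c2 (p1, p2)); constructor 2; exists d; rewrite //= p1E p2E.
Qed.

Lemma chained_column A t r (r' : nat) k i d (j : 'I_n) : chained A t r r' k i ->
  (m < n)%N -> (1 <= d <= r)%N -> j.+1 = k d ->
  exists p, chain_vertex r r' k i p /\ p.2 = j.
Proof.
move=> [[[r1 rr'] kb kd ib id_] c2 _ _] mn dr jE.
case: (eqVneq d 1%N) => [d1|d1].
  have [o oE] := ord_succ (x := 1) ltac:(lia).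
  by exists (o, j); split=> //; constructor 1; rewrite /= oE jE d1.
have [p1 p1E] := ord_succ (x := i d.-1) ltac:(have := ib d.-1; lia).
exists (p1, j); split=> //; constructor 3; exists d.-1; first by lia.
by rewrite /= p1E jE prednK //; lia.
Qed.

Definition update (f : nat -> nat) (x y d : nat) := if d == x then y else f d.

Lemma chained_close A (t s : 'I_n) r k i : (0 < t < m)%N -> (m < n)%N ->
  chained A t r r.-1 k i -> s.+1 = attach_index k r ->
  (forall j, (A t j != 0) = (j == s)) ->
  chained A t.+1 r r k (update i r t.+1).
Proof.
move=> tm mn cA sE row_t; have bnd := chained_bound cA mn.
have [[[r1 _] kb kd ib id_] c2 c3 c4] := cA.
have cv p : chain_vertex r r k (update i r t.+1) p <->
    chain_vertex r r.-1 k i p \/ p = (t, s).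
  have upd d : (1 <= d <= r.-1)%N -> update i r t.+1 d = i d.
    by rewrite /update => dr; case: eqP => // dE; lia.
  split=> [[pE|[d dr pE]|[d dr pE]]|[[pE|[d dr pE]|[d dr pE]]|->]].
  - by left; constructor 1.
  - case: (eqVneq d r) => [dE|dr']; last first.
      left; constructor 2; exists d; first by lia.
      by rewrite -upd //; lia.
    right; apply: pair_ord; rewrite pE dE /= sE; congr pair.
    by rewrite /update eqxx.
  - by left; constructor 3; exists d; rewrite // -upd.
  - by constructor 1.
  - by constructor 2; exists d; [lia | rewrite upd].
  - by constructor 3; exists d; [lia | rewrite upd].
  - by constructor 2; exists r; [lia | rewrite /= sE /update eqxx].
have colS : exists p, chain_vertex r r.-1 k i p /\ p.2 = s.
  move: sE; rewrite /attach_index; case: (comb) => sE.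
    by apply: (chained_column cA mn _ sE); lia.
  by apply: (chained_column cA mn _ sE); lia.
split.
- split=> //; first by split=> //; right.
  + move=> d dr; rewrite /update; case: eqP => // dE; apply: ib; lia.
  + move=> d d' d1 dd' d'r; rewrite /update; case: (eqVneq d' r) => d'E.
      by rewrite ltn_eqF ?ltnS ?bnd //; lia.
    by rewrite ltn_eqF; [apply: id_|]; lia.
- move=> p /cv[/c2|->] /=; lia.
- by move=> p /cv[/c3|->] //=; rewrite row_t eqxx.
- move=> p pt Ap np; have np1 : ~ chain_vertex r r.-1 k i p by move=> h; apply/np/cv; left.
  case: (ltnP p.1 t) => pt'; last first.
    have pE : p.1 = t by apply: val_inj => /=; lia.
    case: np; apply/cv; right; move: Ap; rewrite pE row_t => /eqP p2.
    by apply: pair_ord; rewrite pE p2.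
  have iso := c4 _ pt' Ap np1.
  apply: isolated_grow => // j; rewrite row_t => /eqP ->.
  have [q [cq <-]] := colS; apply: (iso q _ _ _).2; [exact: c2|exact: c3|].
  by apply: contra_notN np1 => /eqP <-.
Qed.

Lemma chained_extend A (t s j : 'I_n) r k i : (0 < t < m)%N -> (m < n)%N ->
  chained A t r r.-1 k i -> s.+1 = attach_index k r ->
  fresh A t j -> (m <= j)%N -> (j.+1 < k r)%N ->
  (forall j', (A t j' != 0) = (j' == s) || (j' == j)) ->
  chained A t.+1 r.+1 r (update k r.+1 j.+1) (update i r t.+1).
Proof.
move=> tm mn cA sE fj mj jk row_t; have bnd := chained_bound cA mn.
have [[[r1 _] kb kd ib id_] c2 c3 c4] := cA.
have updi d : (1 <= d <= r.-1)%N -> update i r t.+1 d = i d.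
  by rewrite /update => dr; case: eqP => // dE; lia.
have updk d : (d <= r)%N -> update k r.+1 j.+1 d = k d.
  by rewrite /update => dr; case: eqP => // dE; lia.
have atk d : (1 <= d <= r)%N ->
    attach_index (update k r.+1 j.+1) d = attach_index k d.
  by rewrite /attach_index => dr; rewrite !updk //; lia.
have cv p : chain_vertex r.+1 r (update k r.+1 j.+1) (update i r t.+1) p <->
    [\/ chain_vertex r r.-1 k i p, p = (t, s) | p = (t, j)].
  split=> [[pE|[d dr pE]|[d dr pE]]|[[pE|[d dr pE]|[d dr pE]]|->|->]].
  - by constructor 1; constructor 1; rewrite -(updk 1%N) //; lia.
  - case: (eqVneq d r) => [dE|dr']; last first.
      constructor 1; constructor 2; exists d; first by lia.
      by rewrite -updi -?atk //; lia.
    constructor 2; apply: pair_ord; rewrite pE dE /= sE atk; last by lia.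
    by rewrite /update eqxx.
  - case: (eqVneq d r) => [dE|dr']; last first.
      constructor 1; constructor 3; exists d; first by lia.
      by rewrite -updi -?updk //; lia.
    constructor 3; apply: pair_ord; rewrite pE dE /=.
    by rewrite /update !eqxx.
  - by constructor 1; rewrite updk //; lia.
  - by constructor 2; exists d; [lia | rewrite updi ?atk //; lia].
  - by constructor 3; exists d; [move=> /=; lia | rewrite updi ?updk //; lia].
  - constructor 2; exists r; first by lia.
    by rewrite /= sE atk ?r1 /= // /update eqxx.
  - constructor 3; exists r; [rewrite /=; lia | by rewrite /= /update !eqxx].
have colS : exists p, chain_vertex r r.-1 k i p /\ p.2 = s.
  move: sE; rewrite /attach_index; case: (comb) => sE.
    by apply: (chained_column cA mn _ sE); lia.
  by apply: (chained_column cA mn _ sE); lia.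
split.
- split=> //; first by split=> //; left.
  + move=> d dr; rewrite /update; case: eqP => dE; first by have := ltn_ord j; lia.
    by apply: kb; lia.
  + move=> d d' d1 dd' d'r; rewrite [X in (_ < X)%N]updk; last by lia.
    rewrite /update; case: (eqVneq d' r.+1) => d'E; last by apply: kd; lia.
    case: (eqVneq d r) => [->//|dr]; apply: ltn_trans jk _; apply: kd; lia.
  + move=> d dr; rewrite /update; case: eqP => // dE; apply: ib; lia.
  + move=> d d' d1 dd' d'r; rewrite /update; case: (eqVneq d' r) => d'E.
      by rewrite ltn_eqF ?ltnS ?bnd //; lia.
    by rewrite ltn_eqF; [apply: id_|]; lia.
- move=> p /cv[/c2|->|->] /=; lia.
- by move=> p /cv[/c3|->|->] //=; rewrite row_t eqxx ?orbT.
- move=> p pt Ap np; have np1 : ~ chain_vertex r r.-1 k i p.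
    by move=> h; apply/np/cv; constructor 1.
  case: (ltnP p.1 t) => pt'; last first.
    have pE : p.1 = t by apply: val_inj => /=; lia.
    case: np; apply/cv; move: Ap; rewrite pE row_t => /orP[] /eqP p2.
      by constructor 2; apply: pair_ord; rewrite pE p2.
    by constructor 3; apply: pair_ord; rewrite pE p2.
  have iso := c4 _ pt' Ap np1.
  apply: isolated_grow => // j'; rewrite row_t => /orP[] /eqP ->; last first.
    exact: (fresh_other_column pt' Ap fj).
  have [q [cq <-]] := colS; apply: (iso q _ _ _).2; [exact: c2|exact: c3|].
  by apply: contra_notN np1 => /eqP <-.
Qed.

Lemma single_entry_nonzero A (t j j' : 'I_n) (c : F) : row t A = c *: e j -> c != 0 ->
  (A t j' != 0) = (j' == j).
Proof.
move=> rE c0; rewrite -row_entry rE mxE unit_row_entry.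
by case: (j' == j); rewrite ?mulr1 ?mulr0 ?eqxx.
Qed.

Lemma plain_row_single A (t j : 'I_n) (c : F) : row t A = c *: e j -> c != 0 -> fresh A t j ->
  plain_row A t.
Proof.
move=> rE c0 fj; split=> [j'|j1 j2]; rewrite !(single_entry_nonzero _ rE c0) => /eqP -> //.
by move/eqP->.
Qed.

Lemma normal_rows_chained A t st : (m < n)%N -> pos_supported m A ->
  normal_rows m comb A t st ->
  match st with
  | None => rook A t \/ exists r k i, chained A t r r k i
  | Some (s, k0) => (0 < t)%N /\ exists r k i,
      [/\ chained A t r r.-1 k i, k0.+1 = k r & s.+1 = attach_index k r]
  end.
Proof.
move=> mn sA; elim=> {t st} [|t st st' nA IH]; first by left=> p; rewrite ltn0.
move rE: (row t A) => x stp; case: st x st' / stp rE nA IH.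
- move=> st rE nA IH; have pl : plain_row A t.
    by split=> [j|j j']; rewrite -row_entry rE mxE eqxx.
  case: st nA IH => [[s k0]|] nA /= IH.
    have [t0 [r [k [i [cA kE sE]]]]] := IH; split=> //; exists r, k, i; split=> //.
    exact: chained_grow.
  case: IH => [rA|[r [k [i cA]]]]; [left; exact: rook_grow|right].
  by exists r, k, i; apply: chained_grow.
- move=> j c t0 c0 rE nA _; split=> //.
  have fj : fresh A t j by apply/freshP => p; rewrite t0.
  have pl := plain_row_single rE c0 fj.
  have pj : in_pattern m t j.
    by apply/contraT => /sA/eqP; have := single_entry_nonzero j rE c0; rewrite eqxx => /negPf ->.
  exists 1%N, (fun=> j.+1), (fun=> 0%N); split=> //; last first.
    by rewrite /attach_index if_same.
  have cp q : chain_vertex 1 0 (fun=> j.+1) (fun=> 0%N) q <-> q = (t, j).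
    split=> [[qE|[d]|[d]]|->]; try lia; last by constructor 1; rewrite /= t0.
    by apply: pair_ord; rewrite qE /= t0.
  split=> [|p /cp-> //|p /cp-> /=|p pt Ap _].
  + split; try lia.
    by move=> d _; move: pj; rewrite /in_pattern t0 /=; have := ltn_ord j; lia.
  + by rewrite (single_entry_nonzero j rE c0) eqxx.
  + by apply: plain_isolated => //; apply: val_inj => /=; lia.
- move=> st j c t0 c0 fj rE nA IH; have pl := plain_row_single rE c0 fj.
  case: st nA IH => [[s k0]|] nA /= IH.
    have [_ [r [k [i [cA kE sE]]]]] := IH; split=> //; exists r, k, i; split=> //.
    exact: chained_grow.
  case: IH => [rA|[r [k [i cA]]]]; [left; exact: rook_grow|right].
  by exists r, k, i; apply: chained_grow.
- move=> s k0 c tm c0 rE nA [t0 [r [k [i [cA kE sE]]]]]; right.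
  exists r, k, (update i r t.+1); apply: (chained_close _ mn cA sE); first by lia.
  by move=> j; apply: single_entry_nonzero rE c0.
- move=> s k0 j c c' tm c0 c'0 fj /andP[mj jk] rE nA [t0 [r [k [i [cA kE sE]]]]].
  split=> //; exists r.+1, (update k r.+1 j.+1), (update i r t.+1).
  have js : j != s.
    have [phi [_ [_ _ h6 h7] _ _ _]] := normal_rows_facts sA nA.
    by apply: contraNneq h6 => js; rewrite -js h7.
  have kn : update k r.+1 j.+1 r.+1 = j.+1 by rewrite /update eqxx.
  split; rewrite ?kn //.
    apply: (chained_extend _ mn cA sE) => // [||j']; [lia|lia|].
    rewrite -row_entry rE !mxE !eqxx /=; case: (eqVneq j' s) => [->|_].
      by rewrite [s == j]eq_sym (negPf js) mulr1 mulr0 addr0 c0.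
    by case: (j' == j); rewrite ?mulr1 ?mulr0 ?add0r ?eqxx ?c'0.
  move: sE; rewrite /attach_index kn; case: (comb) => // ->.
  rewrite /update; have [[[r1 _] _ _ _ _] _ _ _] := cA.
  by case: eqP => //; lia.
Qed.

Lemma row_one_entry A (t j : 'I_n) :
  (forall j', A t j' != 0 -> j' = j) -> row t A = A t j *: e j.
Proof.
move=> h; apply/rowP => j'; rewrite row_entry mxE unit_row_entry.
case: (eqVneq j' j) => [->|j'j]; first by rewrite mulr1.
by rewrite mulr0; apply/eqP; apply: contraNT j'j => /h ->.
Qed.

Lemma row_two_entries A (t s j : 'I_n) : j != s ->
  (forall j', A t j' != 0 -> j' = s \/ j' = j) ->
  row t A = A t s *: e s + A t j *: e j.
Proof.
move=> js h; apply/rowP => j'; rewrite row_entry !mxE eqxx /=.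
case: (eqVneq j' s) => [->|j's].
  by rewrite [s == j]eq_sym (negPf js) mulr1 mulr0 addr0.
case: (eqVneq j' j) => [->|j'j]; first by rewrite mulr0 mulr1 add0r.
rewrite !mulr0 addr0; apply/eqP/contraT => /h[] jE.
  by rewrite jE eqxx in j's.
by rewrite jE eqxx in j'j.
Qed.

Lemma isolated_row_step A (t : 'I_n) st : (0 < t)%N ->
  (forall j, A t j != 0 -> isolated A n (t, j)) ->
  row_step m comb A t st (row t A) st.
Proof.
move=> t0 iso; case: (pickP [pred j | A t j != 0]) => [j /= Aj|h]; last first.
  have -> : row t A = 0.
    by apply/rowP => j; rewrite row_entry mxE; apply/eqP/negbFE/h.
  exact: StepZero.
rewrite (@row_one_entry _ _ j) => [|j' Aj'].
  apply: StepFresh => //; apply/freshP => p pt; apply/eqP/contraT => Apj.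
  have [|_ []] // := iso _ Aj (p, j) (ltn_ord _) Apj.
  by apply/eqP => -[pt']; rewrite pt' ltnn in pt.
apply/eqP/contraT => jj'; have [|[]] // := iso _ Aj (t, j') (ltn_ord _) Aj'.
by apply: contraNneq jj' => -[->].
Qed.

Lemma rook_normal_rows A t : (t <= n)%N -> rook A n ->
  (forall p, p.1 = 0%N :> nat -> A p.1 p.2 = 0) -> normal_rows m comb A t None.
Proof.
move=> tn rA A0; elim: t tn => [_|t IH tn]; first exact: NormalNil.
pose i := Ordinal tn; apply: (@NormalCons _ _ _ _ _ i None _ (IH (ltnW tn))).
case: (posnP i) => i0; last first.
  by apply: isolated_row_step => // j Aij; apply: rA.
have -> : row i A = 0 by apply/rowP => j; rewrite row_entry mxE (A0 (i, j)).
exact: StepZero.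
Qed.

Lemma chained_normal_rows A r (r' : nat) k i t : (0 < t <= n)%N -> (m < n)%N ->
  chained A n r r' k i -> exists (u : nat) st,
  [/\ (u <= r')%N, forall d, (1 <= d <= u)%N -> (i d <= t)%N,
      forall d, (u < d <= r')%N -> (t < i d)%N, normal_rows m comb A t st
    & if (u < r)%N then exists s k0 : 'I_n,
        [/\ st = Some (s, k0), k0.+1 = k u.+1 & s.+1 = attach_index k u.+1]
      else st = None].
Proof.
move=> + mn [[[r1 rr'] kb kd ib id_] _ c3 c4].
elim: t => [//|[|t] IH tn].
  have [j jE] := ord_succ (x := k 1%N) ltac:(have := kb 1%N; lia).
  pose o := Ordinal (andP tn).2; exists 0%N, (Some (j, j)).
  have cj : chain_vertex r r' k i (o, j) by constructor 1; rewrite /= jE.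
  split=> //; try lia.
  - by move=> d dr; have := ib d; lia.
  - apply: (@NormalCons _ _ _ _ _ o None); first exact: NormalNil.
    rewrite (@row_one_entry _ _ j) => [|j' Aj'].
      by apply: StepHead => //; apply: (c3 (o, j)).
    apply/eqP/contraT => jj'.
    have nc : ~ chain_vertex r r' k i (o, j').
      move=> [[]|[d dr [i1 _]]|[d dr [i1 _]]].
      + by rewrite -jE => -[/val_inj jE']; rewrite jE' eqxx in jj'.
      + by have := ib d; lia.
      + by have := ib d; lia.
    have [|[]] // := c4 (o, j') (ltn_ord _) Aj' nc (o, j) (ltn_ord _) (c3 _ cj).
    by apply: contraNneq jj' => -[->].
  - by rewrite r1; exists j, j; rewrite jE /attach_index if_same.
have {IH} [u [st [ur' h1 h2 nA hst]]] := IH ltac:(lia).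
have tn' : (t.+1 < n)%N by lia.
pose o := Ordinal tn'.
have {}nA : normal_rows m comb A o st := nA.
case: (boolP ((u < r')%N && (i u.+1 == t.+2))) => [/andP[ult /eqP iE]|hu]; last first.
  have h2' d : (u < d <= r')%N -> (t.+2 < i d)%N.
    move=> dr; have h3 := h2 _ dr; case: (eqVneq d u.+1) => [dE|du].
      by move: hu; rewrite -dE; lia.
    by have h4 := h2 u.+1 ltac:(lia); have := id_ u.+1 d; lia.
  exists u, st; split=> //.
    by move=> d /h1; lia.
  apply: (NormalCons nA); apply: isolated_row_step => // j Aj.
  apply: c4 => // -[[]//|[d dr [iE _]]|[d dr [iE _]]].
    case: (leqP d u) => du; [have := h1 d | have := h2' d]; lia.
  case: (leqP d u) => du; [have := h1 d | have := h2' d]; lia.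
have ur : (u < r)%N by lia.
move: hst; rewrite ur => -[s [k0 [stE k0E sE]]].
have om : (o < m)%N by have := ib u.+1; rewrite /=; lia.
have h1' d : (1 <= d <= u.+1)%N -> (i d <= t.+2)%N.
  case: (eqVneq d u.+1) => [->|du] dr; first by rewrite iE.
  by have := h1 d; lia.
have h2' d : (u.+1 < d <= r')%N -> (t.+2 < i d)%N by have := id_ u.+1 d; lia.
have dE d : (1 <= d <= r')%N -> t.+2 = i d -> d = u.+1.
  move=> dr iE'; case: (ltngtP d u.+1) => // du.
    by have := id_ d u.+1; lia.
  by have := id_ u.+1 d; lia.
have cs : chain_vertex r r' k i (o, s) by constructor 2; exists u.+1; rewrite ?iE ?sE.
have rowo j : A o j != 0 -> j = s \/ (u.+1 < r)%N /\ j.+1 = k u.+2.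
  move=> Aj; have cj : chain_vertex r r' k i (o, j).
    case: (boolp.EM (chain_vertex r r' k i (o, j))) => // nc.
    case: (eqVneq s j) => [<- //|sj].
    have [|[]] // := c4 (o, j) (ltn_ord _) Aj nc (o, s) (ltn_ord _) (c3 _ cs).
    by apply: contraNneq sj => -[->].
  case: cj => [[]//|[d dr [/(dE _ dr) -> jE]]|[d dr [iE' jE]]].
    by left; apply: val_inj; move: jE; rewrite -sE => -[].
  have dE' : d = u.+1 by apply: dE => //; lia.
  by right; rewrite -dE' jE; split=> //; lia.
case: (ltnP u.+1 r) => u1r; last first.
  exists u.+1, None; split=> //; last by rewrite ltnNge u1r.
  apply: (NormalCons nA); rewrite stE (@row_one_entry _ _ s).
    by apply: StepClose => //; exact: (c3 (o, s)).
  by move=> j /rowo[//|]; lia.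
have [j jE] := ord_succ (x := k u.+2) ltac:(have := kb u.+2; lia).
have kuu : (k u.+2 < k u.+1)%N by apply: kd.
have cj : chain_vertex r r' k i (o, j).
  by constructor 3; exists u.+1; rewrite ?iE ?jE //; lia.
have js : j != s.
  apply: contraTneq isT => js; move: sE; rewrite -js jE /attach_index.
  by case: (comb) => [|] kE; [have := kd 1%N u.+2 |]; lia.
have fj : fresh A o j.
  apply/freshP => p pt; apply/eqP/contraT => Apj.
  have po : (p, j) != (o, j) by apply/eqP => -[pE]; rewrite pE ltnn in pt.
  case: (boolp.EM (chain_vertex r r' k i (p, j))) => [|nc]; last first.
    have [|_ []] // := c4 (p, j) (ltn_ord _) Apj nc (o, j) (ltn_ord _) (c3 _ cj).
    by rewrite eq_sym.
  move: pt => /= pt [[_]|[d dr [iE' jE']]|[d dr [iE' jE']]]; rewrite ?jE.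
  - by have := kd 1%N u.+2; lia.
  - have du : (d <= u)%N by case: (leqP d u) => // du; have := h2 d; lia.
    move: jE'; rewrite jE /attach_index; case: (comb) => [|] kE.
      by have := kd 1%N u.+2; lia.
    by have := kd d u.+2; lia.
  - have du : (d <= u)%N by case: (leqP d u) => // du; have := h2 d; lia.
    by move: jE'; rewrite jE => kE; have := kd d.+1 u.+2; lia.
exists u.+1, (Some (if comb then s else j, j)); split=> //.
  apply: (NormalCons nA); rewrite stE (@row_two_entries _ _ s j) //.
    apply: StepExtend => //; [exact: (c3 (o, s))|exact: (c3 (o, j))|].
    by have := kb u.+2; lia.
  move=> j' /rowo[->|[_ j'E]]; [by left | right].
  by apply: val_inj; move: j'E; rewrite -jE => -[].
rewrite u1r; exists (if comb then s else j), j; split=> //.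
by move: sE; rewrite /attach_index; case: (comb).
Qed.

Theorem representative_normal_rows A : (m < n)%N -> pos_supported m A ->
  chain_representative A <-> exists st, normal_rows m comb A n st.
Proof.
move=> mn sA; have n0 : (0 < n)%N by lia.
split=> [/(representative_chained n0 sA)[[rA A0]|[r [r' [k [i cA]]]]]|[st nA]].
- by exists None; apply: rook_normal_rows.
- have [u [st [_ _ _ nA _]]] := chained_normal_rows (t := n) ltac:(lia) mn cA.
  by exists st.
have := normal_rows_chained mn sA nA; case: st {nA} => [[s k0] [_ [r [k [i [cA _ _]]]]]|].
  exact: chained_representative mn cA.
case=> [|[r [k [i cA]]]]; first exact: rook_representative.
exact: chained_representative mn cA.
Qed.

End Representatives.

Section Orbits.

Variables (F : finFieldType) (n m : nat).
Implicit Types (u v x y : 'M[F]_n) (l mu nu : dual F n m).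

Local Notation Um := (Um F n m).
Local Notation nm := (nm F n m).

Lemma Um1 : 1%:M \in Um.
Proof. by rewrite -[1%:M]add0r -mem_nm mem0v. Qed.

Lemma Um_sub1 u : (u \in Um) = (u - 1%:M \in nm).
Proof. by rewrite mem_nm subrK. Qed.

Lemma nm_mul x y : x \in nm -> y \in nm -> x *m y \in nm.
Proof.
move=> /mem_nmP[x1 x2] /mem_nmP[y1 y2]; apply/mem_nmP.
split=> i j ij; last move=> jm; rewrite mxE big1 // => k _.
  case: (leqP k i) => ki; first by rewrite x1 ?mul0r.
  by rewrite y1 ?mulr0 //; lia.
case: (ltnP k m) => km; first by rewrite x2 ?mul0r.
by rewrite y1 ?mulr0 //; lia.
Qed.

Lemma Um_mul u v : u \in Um -> v \in Um -> u *m v \in Um.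
Proof.
rewrite !Um_sub1 => u1 v1.
have -> : u *m v - 1%:M = (u - 1%:M) *m (v - 1%:M) + (u - 1%:M) + (v - 1%:M).
  by rewrite mulmxBr mulmx1 subrK mulmxBl mul1mx addrA subrK.
by apply: memvD => //; apply: memvD => //; apply: nm_mul.
Qed.

Lemma Um_unitmx u : u \in Um -> u \in unitmx.
Proof.
case/mem_UmP => u1 u2 _; rewrite unitmxE -det_tr det_trig.
  by rewrite big1 ?unitr1 // => i _; rewrite mxE u1.
by apply/is_trig_mxP => i j ij; rewrite mxE u2.
Qed.

Lemma Um_inv u : u \in Um -> invmx u \in Um.
Proof.
move=> uU; have uu := Um_unitmx uU.
have : [set u *m v | v in Um] = Um.
  apply/eqP; rewrite eqEcard card_imset ?leqnn ?andbT; last exact: can_inj (mulKmx uu).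
  by apply/subsetP => _ /imsetP[v vU ->]; apply: Um_mul.
move=> /setP/(_ 1%:M); rewrite Um1 => /imsetP[v vU uv].
by rewrite -[invmx u]mulmx1 uv mulKmx.
Qed.

Lemma nm_act u v x : u \in Um -> v \in Um -> x \in nm -> u *m x *m v \in nm.
Proof.
rewrite !Um_sub1 => u1 v1 xn.
have ux : u *m x \in nm.
  by rewrite -[u](subrK 1%:M) mulmxDl mul1mx memvD // nm_mul.
by rewrite -[v](subrK 1%:M) mulmxDr mulmx1 memvD // nm_mul.
Qed.

Lemma ev_ext l mu : (forall x, x \in nm -> ev l x = ev mu x) -> l = mu.
Proof.
move=> h; apply/lfunP => y; have := h _ (subvsP y).
by rewrite /ev vsvalK.
Qed.

Lemma ev_linear l : linear (ev l : 'M[F]_n -> F^o).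
Proof. by move=> a x y; rewrite /ev linearP [LHS]linearP. Qed.

Lemma invmx_mul u v : u \in unitmx -> v \in unitmx ->
  invmx (u *m v) = invmx v *m invmx u.
Proof.
move=> uu vu; have uvu : u *m v \in unitmx by rewrite unitmx_mul uu.
apply: (can_inj (mulKmx uvu)); rewrite mulmxV // mulmxA mulmxK // mulmxV //.
Qed.

Lemma act_act u v u' v' l : u \in Um -> v \in Um -> u' \in Um -> v' \in Um ->
  act u (act u' l v') v = act (u *m u') l (v' *m v).
Proof.
move=> uU vU u'U v'U; apply: ev_ext => x xn; rewrite !act_val ?nm_act ?Um_inv //.
by rewrite !invmx_mul ?Um_unitmx // !mulmxA.
Qed.

Lemma act1 l : act 1%:M l 1%:M = l.
Proof. by apply: ev_ext => x xn; rewrite act_val // invmx1 mul1mx mulmx1. Qed.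

Lemma two_sided_orbitP l mu :
  reflect (exists u v, [/\ u \in Um, v \in Um & mu = act u l v])
          (mu \in two_sided_orbit l).
Proof.
apply: (iffP imset2P) => [[u v uU vU ->]|[u [v [uU vU ->]]]].
  by exists u, v.
by exists u v.
Qed.

Lemma two_sided_orbit_refl l : l \in two_sided_orbit l.
Proof. by apply/two_sided_orbitP; exists 1%:M, 1%:M; rewrite act1 Um1. Qed.

Lemma two_sided_orbit_sym l mu :
  mu \in two_sided_orbit l -> l \in two_sided_orbit mu.
Proof.
move=> /two_sided_orbitP[u [v [uU vU ->]]]; apply/two_sided_orbitP.
exists (invmx u), (invmx v); rewrite act_act ?Um_inv //.
by rewrite mulVmx ?mulmxV ?act1 ?Um_unitmx.
Qed.

Lemma two_sided_orbit_trans l mu nu : mu \in two_sided_orbit l ->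
  nu \in two_sided_orbit mu -> nu \in two_sided_orbit l.
Proof.
move=> /two_sided_orbitP[u [v [uU vU ->]]] /two_sided_orbitP[u' [v' [u'U v'U ->]]].
apply/two_sided_orbitP; exists (u' *m u), (v *m v').
by rewrite act_act // !Um_mul.
Qed.

Lemma two_sided_orbit_eq l mu :
  mu \in two_sided_orbit l -> two_sided_orbit mu = two_sided_orbit l.
Proof.
move=> ml; apply/setP => nu; apply/idP/idP; first exact: two_sided_orbit_trans.
exact/two_sided_orbit_trans/two_sided_orbit_sym.
Qed.

Lemma card_left_orbit l mu :
  mu \in two_sided_orbit l -> #|left_orbit mu| = #|left_orbit l|.
Proof.
move=> /two_sided_orbitP[u [v [uU vU ->]]].
have -> : left_orbit (act u l v) = [set act 1%:M nu v | nu in left_orbit l].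
  apply/setP => nu; apply/imsetP/imsetP => [[w wU ->]|[_ /imsetP[w wU ->] ->]].
    exists (act (w *m u) l 1%:M); first by apply: imset_f; apply: Um_mul.
    by rewrite !act_act ?Um_mul ?Um1 // mulmx1 !mul1mx.
  exists (w *m invmx u); first by rewrite Um_mul // Um_inv.
  rewrite !act_act ?Um_mul ?Um1 ?Um_inv // -mulmxA mulVmx ?Um_unitmx //.
  by rewrite !mulmx1 !mul1mx.
apply: card_imset; apply: (can_inj (g := fun nu => act 1%:M nu (invmx v))) => nu.
by rewrite act_act ?Um1 ?Um_inv // mulmx1 mulmxV ?Um_unitmx ?act1.
Qed.

Lemma delta_nm i j : (delta_mx i j \in nm) = in_pattern m i j.
Proof.
apply/mem_nmP/andP => [[h1 h2]|[ij /implyP im]].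
  split; first by rewrite ltnNge; apply/negP => /h1/eqP; rewrite mxE !eqxx oner_eq0.
  apply/implyP => /eqP i0; rewrite leqNgt; apply/negP => jm.
  by have /eqP := h2 i j i0 jm; rewrite mxE !eqxx oner_eq0.
split=> i' j'; rewrite mxE.
  by case: eqP => [->|//]; case: eqP => [->|//]; lia.
by case: eqP => [->|//]; case: eqP => [->|//] /eqP/im; lia.
Qed.

Lemma mx_of_dual_supported l : pos_supported m (mx_of_dual l).
Proof. by move=> i j; rewrite mxE delta_nm => /negPf ->. Qed.

Lemma ev_mx_of_dual l x : x \in nm ->
  ev l x = \sum_i \sum_j x i j * mx_of_dual l i j.
Proof.
move=> xn; pose f := HB.pack_for {linear 'M[F]_n -> F^o} (ev l : 'M[F]_n -> F^o)
  (GRing.isLinear.Build _ _ _ _ _ (ev_linear l)).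
rewrite {1}[x]matrix_sum_delta -[ev l]/(f : _ -> _) linear_sum; apply: eq_bigr => i _.
rewrite linear_sum; apply: eq_bigr => j _; rewrite linearZ /= mxE delta_nm.
case: ifP => // /negbT pij; rewrite mulr0.
have /mem_nmP[x1 x2] := xn; rewrite (_ : x i j = 0) ?scale0r //.
move: pij; rewrite negb_and -leqNgt => /orP[/x1 //|].
by rewrite negb_imply -ltnNge => /andP[/eqP i0 jm]; apply: x2.
Qed.

Lemma mx_of_dual_inj : injective (@mx_of_dual F n m).
Proof.
move=> l mu lm; apply: ev_ext => x xn; rewrite !ev_mx_of_dual //.
by rewrite lm.
Qed.

Lemma mx_of_dual_act u v l i j : u \in Um -> v \in Um -> in_pattern m i j ->
  mx_of_dual (act u l v) i j =
    ((invmx u)^T *m mx_of_dual l *m (invmx v)^T) i j.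
Proof.
move=> uU vU pij; rewrite mxE delta_nm pij act_val ?delta_nm // ev_mx_of_dual.
  rewrite exchange_big /= mxE; apply: eq_bigr => q _; rewrite !mxE mulr_suml.
  apply: eq_bigr => p _; rewrite [_^T i p]mxE mulrAC; congr (_ * _).
  rewrite -(mul_delta_mx (0 : 'I_1)) mulmxA -mulmxA -colE -rowE mxE big_ord1.
  by rewrite !mxE.
by rewrite nm_act ?Um_inv ?delta_nm.
Qed.

Lemma Um_lower_unip u : (u \in Um) <-> lower_unip m u^T.
Proof.
split=> [/mem_UmP[u1 u2 u3]|[u1 u2 u3]].
  split=> [i|i j ij|i j j0 i0]; rewrite mxE; [exact: u1|exact: u2|exact: u3].
apply/mem_UmP; split=> [i|i j ij|i j j0 i0].
- by have := u1 i; rewrite mxE.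
- by have := u2 j i ij; rewrite mxE.
- by have := u3 j i j0 i0; rewrite mxE.
Qed.

Lemma orbit_closed l (M L R : 'M[F]_n) :
  (exists2 mu, mu \in two_sided_orbit l & mx_of_dual mu = M) ->
  lower_unip m L -> lower_unip m R ->
  exists2 B, (exists2 mu, mu \in two_sided_orbit l & mx_of_dual mu = B)
           & forall i j, in_pattern m i j -> B i j = (L *m M *m R) i j.
Proof.
move=> [mu ml <-]; rewrite -[L]trmxK -[R]trmxK => /Um_lower_unip LU /Um_lower_unip RU.
exists (mx_of_dual (act (invmx L^T) mu (invmx R^T))).
  exists (act (invmx L^T) mu (invmx R^T)) => //.
  apply: two_sided_orbit_trans ml _; apply/two_sided_orbitP.
  by exists (invmx L^T), (invmx R^T); rewrite !Um_inv.
by move=> i j pij; rewrite mx_of_dual_act ?Um_inv // !invmxK.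
Qed.

Lemma orbit_equiv l mu : mu \in two_sided_orbit l ->
  exists L R, [/\ lower_unip m L, lower_unip m R
    & forall i j, in_pattern m i j -> (L *m mx_of_dual mu) i j = (mx_of_dual l *m R) i j].
Proof.
move=> /two_sided_orbitP[u [v [uU vU ->]]]; exists u^T, (invmx v)^T; split.
- exact/Um_lower_unip.
- exact/Um_lower_unip/Um_inv.
move=> i j pij; have := @mx_of_dual_act (invmx u) 1%:M (act u l v) i j.
rewrite Um_inv // Um1 pij invmxK invmx1 trmx1 mulmx1 => /(_ isT isT isT) <-.
rewrite act_act ?Um_inv ?Um1 // mulVmx ?Um_unitmx // mulmx1.
by rewrite mx_of_dual_act ?Um1 // invmx1 trmx1 mul1mx.
Qed.

Lemma orbit_representative comb l : (m < n)%N -> exists! mu,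
  mu \in two_sided_orbit l /\ chain_representative m comb (mx_of_dual mu).
Proof.
move=> mn.
pose Q M := exists2 mu, mu \in two_sided_orbit l & mx_of_dual mu = M.
have Qs M : Q M -> pos_supported m M.
  by move=> [mu _ <-]; apply: mx_of_dual_supported.
have [|B [st [[mu ml muB] nB]]] :=
  normal_rows_exist Qs (@orbit_closed l) comb (A := mx_of_dual l).
  by exists l => //; apply: two_sided_orbit_refl.
exists mu; split.
  split=> //; apply/representative_normal_rows => //.
    exact: mx_of_dual_supported.
  by rewrite muB; exists st.
move=> nu [nl] /(representative_normal_rows _ mn (mx_of_dual_supported _))[st' nN].
rewrite -muB in nB.
have num : nu \in two_sided_orbit mu.
  exact/(two_sided_orbit_trans _ nl)/two_sided_orbit_sym.
have [L [R [lL lR E]]] := orbit_equiv num.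
have [L' [R' [lL' lR' E']]] := orbit_equiv (two_sided_orbit_sym num).
have [_ h] := normal_rows_unique (@mx_of_dual_supported _) (@mx_of_dual_supported _)
  lL lR lL' lR' E E' nN nB.
by apply/esym/mx_of_dual_inj/row_matrixP => i; apply: h.
Qed.

End Orbits.

Section SupercharacterSeparation.

Variables (F : finFieldType) (n m : nat) (C : numFieldType) (theta : F -> C).
Hypothesis theta_unit : forall a, theta a != 0.
Hypothesis theta_add : forall a b, theta (a + b) = theta a * theta b.
Hypothesis theta_nontrivial : exists a, theta a != 1.
Implicit Types (u v x y : 'M[F]_n) (l mu nu : dual F n m).

Local Notation Um := (Um F n m).
Local Notation nm := (nm F n m).

Lemma theta0 : theta 0 = 1.
Proof. by apply: (mulfI (theta_unit 0)); rewrite -theta_add addr0 mulr1. Qed.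

Lemma evD l x y : ev l (x + y) = ev l x + ev l y.
Proof. by have := ev_linear l 1 x y; rewrite !scale1r. Qed.

Lemma evZ l a x : ev l (a *: x) = a * ev l x.
Proof.
have ev0 : ev l 0 = 0.
  by apply: (addrI (ev l 0)); rewrite -evD !addr0.
by have := ev_linear l a x 0; rewrite !addr0 ev0 addr0.
Qed.

Lemma theta_orthogonality l mu :
  \sum_(x in Um) theta (ev l (x - 1%:M)) * theta (- ev mu (x - 1%:M))
    = (l == mu)%:R * #|Um|%:R.
Proof.
pose f x := theta (ev l (x - 1%:M) - ev mu (x - 1%:M)).
rewrite (eq_bigr f) => [|x _]; last by rewrite -theta_add.
case: (eqVneq l mu) => [lm|lm].
  rewrite mul1r (eq_bigr (fun=> 1)) ?sumr_const // => x _.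
  by rewrite /f lm subrr theta0.
rewrite mul0r; have [a a1] := theta_nontrivial.
have [y yn yE] : exists2 y, y \in nm & ev l y - ev mu y = a.
  case: (pickP [pred y | (y \in nm) && (ev l y != ev mu y)]) => [y|h].
    rewrite /= -subr_eq0 => /andP[yn d0].
    exists ((a / (ev l y - ev mu y)) *: y); first exact: memvZ.
    by rewrite !evZ -mulrBr divfK.
  case/eqP: lm; apply: ev_ext => y yn; apply/eqP/negbFE.
  by have := h y; rewrite /= yn.
have fD x : f (x + y) = f x * theta a.
  by rewrite /f addrAC !evD -theta_add -yE; congr theta; ring.
have : \sum_(x in Um) f x = (\sum_(x in Um) f x) * theta a.
  rewrite [LHS](reindex_inj (addIr y)) mulr_suml /=; apply: eq_big => [x|x _].
    by rewrite !Um_sub1 addrAC rpredDr.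
  exact: fD.
move/eqP; rewrite -subr_eq0 -{1}[X in X - _]mulr1 -mulrBr mulf_eq0 subr_eq0.
by rewrite [1 == _]eq_sym (negPf a1) orbF => /eqP.
Qed.

Lemma supercharacter_orbit l mu :
  supercharacter theta l = supercharacter theta mu -> l \in two_sided_orbit mu.
Proof.
pose K nu : C := #|left_orbit nu|%:R / #|two_sided_orbit nu|%:R.
have K0 nu : K nu != 0.
  rewrite mulf_neq0 ?invr_eq0 // pnatr_eq0 -lt0n; apply/card_gt0P.
    exists nu; apply/imsetP; exists 1%:M; [exact: Um1|by rewrite act1].
  by exists nu; apply: two_sided_orbit_refl.
move=> E; pose S nu := \sum_(x in Um) theta (ev l (x - 1%:M)) *
  (K nu * \sum_(ka in two_sided_orbit nu) theta (- ev ka (x - 1%:M))).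
have SE nu : S nu = K nu * ((l \in two_sided_orbit nu)%:R * #|Um|%:R).
  rewrite /S (eq_bigr (fun x => K nu * \sum_(ka in two_sided_orbit nu)
      theta (ev l (x - 1%:M)) * theta (- ev ka (x - 1%:M)))); last first.
    by move=> x _; rewrite mulrCA; congr (_ * _); rewrite mulr_sumr.
  rewrite -mulr_sumr exchange_big; congr (_ * _).
  rewrite (eq_bigr _ (fun ka _ => theta_orthogonality l ka)) -mulr_suml.
  congr (_ * _); case: (boolP (l \in _)) => lnu.
    rewrite (bigD1 l) //= eqxx big1 ?addr0 // => ka /andP[_ /negPf].
    by rewrite eq_sym => ->.
  rewrite big1 // => ka kanu; case: eqP => // lka.
  by rewrite lka kanu in lnu.
have SS : S l = S mu.
  apply: eq_bigr => x xU; congr (_ * _).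
  by move/ffunP/(_ (exist _ x xU)): E; rewrite !ffunE.
have Um0 : #|Um|%:R != 0 :> C.
  by rewrite pnatr_eq0 -lt0n; apply/card_gt0P; exists 1%:M; apply: Um1.
move/eqP: SS; rewrite !SE two_sided_orbit_refl mul1r; apply: contraTT => /negPf ->.
by rewrite mul0r mulr0 mulf_neq0.
Qed.

Lemma supercharacter_eq l mu : mu \in two_sided_orbit l ->
  supercharacter theta mu = supercharacter theta l.
Proof.
move=> ml; apply/ffunP => x; rewrite !ffunE.
by rewrite (two_sided_orbit_eq ml) (card_left_orbit ml).
Qed.

Lemma unique_supercharacter_representatives (T : dual F n m -> Prop) :
  (forall l, exists! mu, mu \in two_sided_orbit l /\ T mu) ->
  supercharacter_representatives theta T.
Proof.
move=> T_unique; split=> // [l mu Tl Tmu /supercharacter_orbit lmu|l].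
  have [nu [_ nu_unique]] := T_unique mu.
  by rewrite -(nu_unique l) // -(nu_unique mu) //; split=> //; apply: two_sided_orbit_refl.
have [mu [[ml Tmu] _]] := T_unique l; exists mu; split=> //.
exact: supercharacter_eq.
Qed.

End SupercharacterSeparation.

Theorem proposition3p2 (F : finFieldType) (R : realType)
    (theta : F -> complex R)
    (theta_unit : forall a : F, theta a != 0)
    (theta_add : forall a b : F, theta (a + b) = theta a * theta b)
    (theta_nontrivial : exists a : F, theta a != 1)
    (n m : nat) (m_gt0 : (0 < m)%N) (m_lt_n : (m < n)%N) :
  supercharacter_representatives theta (@comb_representative F n m) /\
  supercharacter_representatives theta (@path_representative F n m).
Proof.
split; apply: (@unique_supercharacter_representatives _ _ _ (complex R)) => // l.
  exact: (orbit_representative true).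
exact: (orbit_representative false).
Qed.
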